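(* Let $p$ be prime and $a\in\mathbb{Z}_p^\times$. Then $D(\lambda_a)\le C\,p^{1/2}\log^2 p$ for an absolute constant $C$ (independent of $a$).
   Context: $\lambda_a$ is the permutation of $\mathbb{Z}_p$ defined by $\lambda_a(s)=as^{-1}$ for $s\in\mathbb{Z}_p^\times$ and $\lambda_a(0)=0$. An interval of $\mathbb{Z}_n$ is any subset that is the image of an interval of consecutive integers under the projection $\mathbb{Z}\to\mathbb{Z}_n$ (wrap-around allowed). For $S,T\subseteq\mathbb{Z}_n$, $D_T(S)=\bigl|\,|S\cap T|-|S||T|/n\,\bigr|$, and for a permutation $\sigma$ of $\mathbb{Z}_n$, $D(\sigma)=\max_{I,J}D_J(\sigma(I))$ over all intervals $I,J$ of $\mathbb{Z}_n$. *)

(* Defs.v *)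
From mathcomp Require Import all_boot all_algebra.
From Stdlib Require Import Reals ClassicalEpsilon.
Set Implicit Arguments. Unset Strict Implicit. Unset Printing Implicit Defensive.
Import GRing.Theory.

Definition lambda_map (n : nat) (a : 'Z_n) (s : 'Z_n) : 'Z_n :=
  if s == GRing.zero then GRing.zero else GRing.mul a (GRing.inv s).

Definition is_interval (n : nat) (I : {set 'Z_n}) : Prop :=
  exists (k : int) (m : nat),
    I = [set x : 'Z_n | [exists i : 'I_m, x == intmul (GRing.one _) (GRing.add k (Posz (nat_of_ord i)))]].

Definition is_intervalb (n : nat) (I : {set 'Z_n}) : bool :=
  if excluded_middle_informative (is_interval I) then true else false.

Definition discr (n : nat) (T S : {set 'Z_n}) : R :=
  Rabs (Rminus (INR #|S :&: T|) (Rdiv (Rmult (INR #|S|) (INR #|T|)) (INR n))).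

Definition Dperm (n : nat) (sigma : 'Z_n -> 'Z_n) : R :=
  \big[Rmax/R0]_(I : {set 'Z_n} | is_intervalb I)
    \big[Rmax/R0]_(J : {set 'Z_n} | is_intervalb J) discr J (sigma @: I).

(* Main.v *)
Require Import Defs.
From Stdlib Require Import Reals Lra ClassicalEpsilon.
From mathcomp Require Import all_boot all_order all_algebra all_field.
From mathcomp Require Import complex Rstruct.
From mathcomp Require Import zify ring.
Set Implicit Arguments. Unset Strict Implicit. Unset Printing Implicit Defensive.
Import Order.TTheory GRing.Theory Num.Theory.
Local Open Scope ring_scope.

(** Expanding the indicator functions of [I] and [J] in additive characters
    reduces the discrepancy to Kloosterman sums [K = \sum_x zeta^(x + b/x)]; the
    Fourier transform of an interval has l1-norm [O(p log p)], so the theorem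
    follows from [|K| <= 3 sqrt p].

    Let [S_n] be the Kloosterman sum over [F_(p^n)].  Counting monic quadratics
    through their roots gives [S_(2n) = 2 p^n - S_n^2].  Stepanov's method bounds,
    for [q = p^(2s)] and each [c], the number of [x] in [F_q] with
    [Tr (x + b/x) = c] by [q/p + O_p(sqrt q)]; summing over [c], this also bounds
    these numbers from below, so that [S_(2s) = O_p(p^s)].  Were [|S_1| > 3 sqrt p],
    the recursion would make [|S_(2^m)| / p^(2^(m-1))] unbounded. *)

(** * Congruences and linear algebra for polynomials *)

(** Over [F_q] alone the Stepanov constant grows with [p], so it says nothing useful about [S_1]; it
    is fixed along the tower, however, and the recursion turns any fixed constant into a
    contradiction. In terms of [t_n = S_n / p^(n/2)] the recursion reads [t_(2n) = 2 - t_n^2], whose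
    orbits escape once [|t| > 2]. It is the identity that follows from [S_n = -(A^n + B^n)] with
    [A B = p], but it is obtained here by counting, without an L-function. The threshold 3 instead
    of 2 leaves room for a crude induction with linear growth.

    In characteristic [p] vanishing to high order cannot be read off ordinary derivatives. It is
    expressed instead as divisibility by [X^P - x^P = (X - x)^P] with [P = sqrt q], so that checking
    it amounts to reducing exponents. The reduced forms are polynomial in [x], so one linear system
    serves all points of a fibre at once. *)

Section Congruence.
Variables (F : fieldType) (d : {poly F}).
Implicit Types u v w : {poly F}.

Definition eqmodp u v := d %| u - v.

Lemma eqmodp_refl u : eqmodp u u.
Proof. by rewrite /eqmodp subrr dvdp0. Qed.

Lemma eqmodp_trans u v w : eqmodp u v -> eqmodp v w -> eqmodp u w.
Proof. by move=> h1 h2; rewrite /eqmodp -(subrKA v) dvdp_add. Qed.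

Lemma eqmodpD u u' v v' : eqmodp u u' -> eqmodp v v' -> eqmodp (u + v) (u' + v').
Proof. by move=> h1 h2; rewrite /eqmodp opprD addrACA dvdp_add. Qed.

Lemma eqmodpM u u' v v' : eqmodp u u' -> eqmodp v v' -> eqmodp (u * v) (u' * v').
Proof.
move=> h1 h2; rewrite /eqmodp.
have -> : u * v - u' * v' = (u - u') * v + u' * (v - v').
  by rewrite mulrBl mulrBr addrA subrK.
by apply: dvdp_add; [apply: dvdp_mulr | apply: dvdp_mull].
Qed.

Lemma eqmodpMl w u v : eqmodp u v -> eqmodp (w * u) (w * v).
Proof. exact/eqmodpM/eqmodp_refl. Qed.

Lemma eqmodpX u v n : eqmodp u v -> eqmodp (u ^+ n) (v ^+ n).
Proof.
move=> h; elim: n => [|n IHn]; first exact: eqmodp_refl.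
by rewrite !exprS; apply: eqmodpM.
Qed.

Lemma eqmodp_sum (I : Type) (r : seq I) (A : pred I) (f g : I -> {poly F}) :
  (forall i, A i -> eqmodp (f i) (g i)) ->
  eqmodp (\sum_(i <- r | A i) f i) (\sum_(i <- r | A i) g i).
Proof.
move=> h; elim/big_rec2: _ => [|i u v Ai uv]; first exact: eqmodp_refl.
by apply: eqmodpD => //; apply: h.
Qed.

End Congruence.

Section BivariateBox.
Variable F : fieldType.
Implicit Types u v : {poly {poly F}}.

(* [u] has degree at most [a] in the inner variable and [b] in the outer one. *)
Definition in_box (a b : nat) u :=
  (forall i, size (u`_i)%R <= a.+1)%N /\ (size u <= b.+1)%N.

Lemma in_box_le a b a' b' u :
  (a <= a')%N -> (b <= b')%N -> in_box a b u -> in_box a' b' u.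
Proof.
move=> aa bb [h1 h2]; split=> [i|].
  by apply: leq_trans (h1 i) _; rewrite ltnS.
by apply: leq_trans h2 _; rewrite ltnS.
Qed.

Lemma in_boxD a b u v : in_box a b u -> in_box a b v -> in_box a b (u + v).
Proof.
move=> [h1 h2] [k1 k2]; split=> [i|].
  by rewrite coefD; apply: leq_trans (size_polyD _ _) _; rewrite geq_max h1 k1.
by apply: leq_trans (size_polyD _ _) _; rewrite geq_max h2 k2.
Qed.

Lemma in_boxN a b u : in_box a b u -> in_box a b (- u).
Proof. by move=> [h1 h2]; split=> [i|]; rewrite ?coefN size_polyN. Qed.

Lemma in_box0 a b : in_box a b 0.
Proof. by split=> [i|]; rewrite ?coef0 size_poly0. Qed.

Lemma in_box_sum a b (I : Type) (r : seq I) (A : pred I) (f : I -> {poly {poly F}}) :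
  (forall i, A i -> in_box a b (f i)) -> in_box a b (\sum_(i <- r | A i) f i).
Proof.
move=> h; elim/big_ind: _ => //; first exact: in_box0.
exact: in_boxD.
Qed.

Lemma in_boxM a b c d u v :
  in_box a b u -> in_box c d v -> in_box (a + c) (b + d) (u * v).
Proof.
move=> [h1 h2] [k1 k2]; split=> [i|].
  rewrite coefM; apply: leq_trans (size_sum _ _ _) _; apply/bigmax_leqP => j _.
  apply: leq_trans (size_polyMleq _ _) _.
  have := leq_add (h1 j) (k1 (i - j)%N); rewrite addSn addnS.
  by case: (_ + _)%N => //= m; rewrite ltnS.
apply: leq_trans (size_polyMleq _ _) _.
have := leq_add h2 k2; rewrite addSn addnS.
by case: (_ + _)%N => //= m; rewrite ltnS.
Qed.

Lemma in_boxX a b u n : in_box a b u -> in_box (a * n) (b * n) (u ^+ n).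
Proof.
move=> h; elim: n => [|n IHn].
  rewrite !muln0 expr0; split=> [i|]; last by rewrite size_poly1.
  by rewrite coef1; case: (i == 0)%N; rewrite ?size_poly1 ?size_poly0.
by rewrite exprS !mulnS; apply: in_boxM.
Qed.

Lemma in_box_innerXn n : in_box n 0 ('X^n)%:P.
Proof.
split=> [i|]; last exact: size_polyC_leq1.
by rewrite coefC; case: (i == 0)%N; rewrite ?size_poly0 ?size_polyXn.
Qed.

Lemma in_box_outerXn n : in_box 0 n 'X^n.
Proof.
split=> [i|]; last by rewrite size_polyXn.
by rewrite coefXn; case: (i == n)%N; rewrite ?size_poly0 ?size_poly1.
Qed.

Lemma in_boxC c : in_box 0 0 (c%:P)%:P.
Proof.
split=> [i|]; last exact: size_polyC_leq1.
by rewrite coefC; case: (i == 0)%N; rewrite ?size_poly0 ?size_polyC_leq1.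
Qed.

End BivariateBox.

Lemma nontrivial_linear_relation (F : fieldType) (U V : finType)
    (M : U -> V -> F) :
  (#|V| < #|U|)%N ->
  exists2 v : U -> F, exists u, v u != 0 & forall x, \sum_u v u * M u x = 0.
Proof.
move=> ltVU.
pose A : 'M[F]_(#|U|, #|V|) := \matrix_(i, j) M (enum_val i) (enum_val j).
have : kermx A != 0.
  rewrite kermx_eq0 -row_leq_rank -ltnNge.
  exact: leq_ltn_trans (rank_leq_col A) ltVU.
case/rowV0Pn => r /sub_kermxP rA /rV0Pn[i ri].
exists (fun u => r 0 (enum_rank u)); first by exists (enum_val i); rewrite enum_valK.
move=> x; move/rowP: rA => /(_ (enum_rank x)); rewrite !mxE => rA0.
rewrite -[RHS]rA0 (reindex (@enum_val U predT)) /=; last first.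
  by exists enum_rank => ? _; rewrite ?enum_valK ?enum_rankK.
apply: eq_bigr => j _; by rewrite enum_valK !mxE enum_rankK.
Qed.

(* Modulo [X^P - x^P] the monomial [X^i x^d] becomes
   [X^(i %% P) x^(d + P (i %/ P))], so that only [P (a + b + 1)] linear
   conditions are needed, uniformly in [x]. *)
Lemma combination_divisible (F : fieldType) (U : finType)
    (w : U -> {poly {poly F}}) (a b P : nat) :
  (0 < P)%N -> (forall u, in_box a b (w u)) -> (P * (a + b).+1 < #|U|)%N ->
  exists2 v : U -> F, exists u, v u != 0 &
    forall x : F, 'X^P - (x ^+ P)%:P %| \sum_u v u *: (w u).[x%:P].
Proof.
move=> P0 wbox ltU.
(* [M u (e, f)] is the coefficient of [X^e x^f] after the reduction. *)
pose M u (ed : 'I_P * 'I_(a + b).+1) :=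
  \sum_(i < a.+1) \sum_(d < b.+1 |
    (i %% P == ed.1)%N && (d + P * (i %/ P) == ed.2)%N) (w u)`_d`_i.
have [|v v0 vM] := @nontrivial_linear_relation F U _ M.
  by rewrite card_prod !card_ord.
exists v => // x; set D := 'X^P - _.
have XP : eqmodp D 'X^P (x ^+ P)%:P by apply: dvdpp.
have red u : eqmodp D (w u).[x%:P]
    (\sum_(ed : 'I_P * 'I_(a + b).+1) (M u ed * x ^+ ed.2) *: 'X^(ed.1)).
  have [wb1 wb2] := wbox u.
  have -> : (w u).[x%:P] =
      \sum_(i < a.+1) \sum_(d < b.+1) (w u)`_d`_i *: (x ^+ d *: 'X^i).
    rewrite (horner_coef_wide _ wb2) exchange_big /=; apply: eq_bigr => d _.
    rewrite [X in X * _ = _](_ : _ = \sum_(i < a.+1) (w u)`_d`_i *: 'X^i).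
      rewrite mulr_suml; apply: eq_bigr => i _.
      by rewrite -polyC_exp -scalerAl mulrC mul_polyC.
    rewrite -{1}[(w u)`_d]coefK poly_def [LHS](big_ord_widen _ (fun i => (w u)`_d`_i *: 'X^i) (wb1 d)).
    rewrite big_mkcond; apply: eq_bigr => i _; case: ltnP => // h.
    by rewrite nth_default ?scale0r.
  have -> : \sum_(ed : 'I_P * 'I_(a + b).+1) (M u ed * x ^+ ed.2) *: 'X^(ed.1)
    = \sum_(i < a.+1) \sum_(d < b.+1)
        (w u)`_d`_i *: (x ^+ (d + P * (i %/ P)) *: 'X^(i %% P)) :> {poly F}.
    under eq_bigr => ed _.
      rewrite /M mulr_suml scaler_suml.
      under eq_bigr => i _ do rewrite mulr_suml scaler_suml.
      over.
    rewrite exchange_big; apply: eq_bigr => i _ /=.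
    rewrite (exchange_big_dep predT) //=; apply: eq_bigr => d _.
    have h1 : (i %% P < P)%N by rewrite ltn_mod.
    have h2 : (d + P * (i %/ P) < (a + b).+1)%N.
      rewrite ltnS addnC leq_add //; last by rewrite -ltnS.
      by rewrite mulnC; apply: leq_trans (leq_trunc_div _ _) _; rewrite -ltnS.
    rewrite (big_pred1 (Ordinal h1, Ordinal h2)) ?scalerA //.
    by case=> e f /=; rewrite xpair_eqE /= -!val_eqE /= ![_ == val _]eq_sym.
  apply: eqmodp_sum => i _; apply: eqmodp_sum => d _.
  rewrite -!mul_polyC; apply: eqmodpMl.
  rewrite exprD rmorphM -mulrA; apply: eqmodpMl.
  rewrite {1}(divn_eq i P) exprD [(_ %/ _ * _)%N]mulnC !exprM rmorphXn.
  exact/eqmodpM/eqmodp_refl/eqmodpX.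
have : eqmodp D (\sum_u v u *: (w u).[x%:P])
   (\sum_u v u *: \sum_(ed : 'I_P * 'I_(a + b).+1) (M u ed * x ^+ ed.2) *: 'X^(ed.1)).
  by apply: eqmodp_sum => u _; rewrite -!mul_polyC; apply: eqmodpMl.
rewrite [X in eqmodp _ _ X](_ : _ = 0) /eqmodp ?subr0 //.
under eq_bigr => u _ do rewrite scaler_sumr.
rewrite exchange_big big1 // => ed _ /=.
under eq_bigr => u _ do rewrite scalerA mulrA.
by rewrite -scaler_suml -mulr_suml vM mul0r scale0r.
Qed.

(** Among the terms with nonzero coefficient, the one of largest degree has a leading term that
    nothing can cancel. *)
Lemma sum_distinct_sizes_neq0 (F : fieldType) (U : finType)
    (t : U -> {poly F}) (v : U -> F) :
  (forall u, t u != 0) -> injective (fun u => size (t u)) ->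
  (exists u, v u != 0) -> \sum_u v u *: t u != 0.
Proof.
move=> t0 tinj [u0 vu0].
case: (@arg_maxnP _ u0 (fun u => v u != 0) (fun u => size (t u)) vu0) => u vu umax.
apply/eqP => /(congr1 (fun w : {poly F} => w`_(size (t u)).-1)); rewrite coef0 coef_sum.
rewrite (bigD1 u) //= big1 ?addr0 => [|u' u'u].
  by rewrite coefZ => /eqP; rewrite mulf_eq0 (negPf vu) -/(lead_coef _) lead_coef_eq0 (negPf (t0 u)).
rewrite coefZ; have [-> | vu'] := eqVneq (v u') 0; first by rewrite mul0r.
rewrite nth_default ?mulr0 // -ltnS prednK ?lt0n ?size_poly_eq0 ?t0 //.
rewrite ltn_neqAle [X in _ && X](umax _ vu') andbT.
by apply: contra u'u => /eqP /tinj ->.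
Qed.

(** The [P]-th powers at distinct points are coprime, so their product divides [w]. *)
Lemma card_multiple_roots (F : fieldType) (P : nat) (w : {poly F}) (r : seq F) :
  w != 0 -> uniq r -> (forall x, x \in r -> ('X - x%:P) ^+ P %| w) ->
  (size r * P < size w)%N.
Proof.
move=> w0 ur h.
have : \prod_(x <- r) ('X - x%:P) ^+ P %| w.
  elim: r ur h => [|x r IHr] /=; first by rewrite big_nil dvd1p.
  case/andP=> xr ur h; rewrite big_cons Gauss_dvdp; last first.
    rewrite coprimep_expl // coprimep_sym coprimep_XsubC /root horner_prod.
    rewrite prodf_seq_neq0; apply/allP => y yr; rewrite horner_exp hornerXsubC.
    by rewrite expf_neq0 // subr_eq0; apply: contraNneq xr => ->.
  rewrite h ?mem_head // IHr // => y yr; apply: h; by rewrite inE yr orbT.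
rewrite prodrXl => /(dvdp_leq w0); apply: leq_trans.
have : (\prod_(x <- r) ('X - x%:P)) \is monic by apply: monic_prod_XsubC.
move=> mon; rewrite -[X in (_ < X)%N]prednK ?size_exp ?size_prod_XsubC //.
by rewrite size_poly_gt0 monic_neq0 // monic_exp.
Qed.

(** * Stepanov's method *)

Section Frobenius.
Variables (R : comNzRingType) (p : nat).
Hypothesis charR : p \in [pchar R].

Lemma pchar_nat_exp n : [pchar R].-nat (p ^ n)%N.
Proof. by rewrite pnatX (pnatE _ (pcharf_prime charR)) charR. Qed.

Lemma exprD_pchar_exp n (x y : R) : (x + y) ^+ (p ^ n) = x ^+ (p ^ n) + y ^+ (p ^ n).
Proof. exact/exprDn_pchar/pchar_nat_exp. Qed.

Lemma exprB_pchar_exp n (x y : R) : (x - y) ^+ (p ^ n) = x ^+ (p ^ n) - y ^+ (p ^ n).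
Proof. by apply/eqP; rewrite eq_sym subr_eq -exprD_pchar_exp subrK. Qed.

Lemma expr_sum_pchar_exp n (I : Type) (r : seq I) (A : pred I) (f : I -> R) :
  (\sum_(i <- r | A i) f i) ^+ (p ^ n) = \sum_(i <- r | A i) f i ^+ (p ^ n).
Proof.
elim/big_rec2: _ => [|i x y _ <-]; last exact: exprD_pchar_exp.
by rewrite expr0n expn_eq0 -leqn0 leqNgt prime_gt0 // (pcharf_prime charR).
Qed.

Lemma expr_pchar_fix (x : R) n : x ^+ p = x -> x ^+ (p ^ n) = x.
Proof. by move=> xp; elim: n => [|n IHn] //; rewrite expnS exprM xp. Qed.

End Frobenius.

(** The trace from [F_(p^n)] to [F_p] on elements fixed by the [n]-th Frobenius. As a plain power
    sum it serves all subfields of one ambient field. *)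
Definition frob_trace (R : comNzRingType) (p n : nat) (x : R) : R :=
  \sum_(i < n) x ^+ (p ^ i).

Section Stepanov.
Variables (E : finFieldType) (p s' : nat) (b c : E).
Let s := s'.+1.
Let P := (p ^ s)%N.
(** With [q = p^(2s)], this is [q / p], the largest exponent in the trace: multiplying by [X^Q]
    clears its denominators. Likewise [P] is [sqrt q]. *)
Let Q := (p ^ (s + s'))%N.
Hypotheses (charE : p \in [pchar E]) (card_E : #|E| = (p ^ (s + s))%N).
Hypothesis bp : b ^+ p = b.

Let p_gt1 : (1 < p)%N. Proof. exact/prime_gt1/(pcharf_prime charE). Qed.
Let p_gt0 : (0 < p)%N. Proof. exact: ltnW. Qed.
Let P_gt0 : (0 < P)%N. Proof. by rewrite expn_gt0 p_gt0. Qed.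
Let Q_gt0 : (0 < Q)%N. Proof. by rewrite expn_gt0 p_gt0. Qed.
Let P_le_Q : (P <= Q)%N. Proof. by rewrite leq_exp2l ?leq_addr. Qed.
Let pQ : (p * Q = P * P)%N. Proof. by rewrite -expnS -addnS expnD. Qed.
Let qE : (p ^ (s + s) = p * Q)%N. Proof. by rewrite -expnS -addnS. Qed.
Let QE : (Q = P * p ^ s')%N. Proof. by rewrite -expnD. Qed.

(* [G = X^Q Tr (X + b/X)]. *)
Let G : {poly E} := \sum_(i < s + s) ('X^(Q + p ^ i) + b *: 'X^(Q - p ^ i)).

Let size_G : size G = (Q + Q).+1.
Proof.
rewrite /G addnS big_ord_recr /= -/Q subnn addrA addrAC addrC.
rewrite size_polyDl size_polyXn // ltnS.
apply: leq_trans (size_polyD _ _) _; rewrite geq_max; apply/andP; split.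
  apply: leq_trans (size_sum _ _ _) _; apply/bigmax_leqP => i _.
  have lt_iQ : (p ^ i < Q)%N by rewrite ltn_exp2l //; apply: ltn_ord.
  apply: leq_trans (size_polyD _ _) _; rewrite geq_max size_polyXn.
  rewrite ltn_add2l lt_iQ /=; apply: leq_trans (size_scale_leq _ _) _.
  rewrite size_polyXn; apply: leq_ltn_trans (leq_subr _ _) _.
  by rewrite -[X in (X < _)%N]addn0 ltn_add2l.
apply: leq_trans (size_scale_leq _ _) _; rewrite size_polyXn.
by rewrite addn_gt0 Q_gt0.
Qed.

(* At a point [x] with [Tr (x + b/x) = c], the terms [i >= s] of the trace are
   constant modulo [X^P - x^P] and equal to [c] minus the terms [i < s] taken at
   [x]; hence [x^P G] is congruent to [x^Q H(X, x)], see [eqG]. *)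
Let H : {poly {poly E}} :=
  \sum_(i < s) ('X^P * ('X^(p ^ i))%:P + b%:P%:P * ('X^(P - p ^ i))%:P)
  + c%:P%:P * 'X^P - \sum_(i < s) ('X^(P + p ^ i) + b%:P%:P * 'X^(P - p ^ i)).

Let exp_le_P (i : 'I_s) : (p ^ i <= P)%N.
Proof. by rewrite leq_exp2l // ltnW. Qed.

Let box_H : in_box P (2 * P) H.
Proof.
have le2P : (P <= 2 * P)%N by rewrite leq_pmull.
have box_c d : in_box 0 0 (d%:P%:P : {poly {poly E}}) by exact: in_boxC.
apply: in_boxD; [apply: in_boxD; [apply: in_box_sum => i _; apply: in_boxD|]|].
- apply: in_box_le (in_boxM (in_box_outerXn _ _) (in_box_innerXn _ _));
    by rewrite ?addn0 ?add0n ?exp_le_P.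
- by apply: in_box_le (in_boxM (box_c _) (in_box_innerXn _ _)); rewrite ?add0n ?leq_subr.
- by apply: in_box_le (in_boxM (box_c _) (in_box_outerXn _ _)).
apply/in_boxN/in_box_sum => i _; apply: in_boxD.
  apply: in_box_le (in_box_outerXn _ _) => //.
  by rewrite mul2n -addnn leq_add2l.
apply: in_box_le (in_boxM (box_c _) (in_box_outerXn _ _)) => //.
by rewrite add0n (leq_trans (leq_subr _ _)).
Qed.

Section AtPoint.
Variable x : E.
Hypotheses (x0 : x != 0) (tr_x : frob_trace p (s + s) (x + b / x) = c).
Let D : {poly E} := 'X^P - (x ^+ P)%:P.

Let eqXP m : eqmodp D ('X^(P * m)) (x ^+ (P * m))%:P.
Proof. by rewrite !exprM rmorphXn; apply/eqmodpX/dvdpp. Qed.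

(** The source of the gain: a factor [X^q] has degree [q], yet costs only degree 1 in [x] after
    reduction. *)
Let eqXq : eqmodp D 'X^(p ^ (s + s)) x%:P.
Proof.
rewrite -{1}(expf_card x) card_E expnD; exact: eqXP.
Qed.

Let eqXQ : eqmodp D 'X^Q (x ^+ Q)%:P.
Proof. rewrite QE; exact: eqXP. Qed.

Let exp_term i : (x + b / x) ^+ (p ^ i) = x ^+ (p ^ i) + b / x ^+ (p ^ i).
Proof.
by rewrite (exprD_pchar_exp charE) expr_div_n (expr_pchar_fix _ bp).
Qed.

Let eqG : eqmodp D ((x ^+ P)%:P * G) ((x ^+ Q)%:P * H.[x%:P]).
Proof.
have upper : \sum_(i < s) (x + b / x) ^+ (p ^ (s + i)) =
    c - \sum_(i < s) (x + b / x) ^+ (p ^ i).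
  by rewrite -tr_x /frob_trace big_split_ord /= [X in X - _]addrC addrK.
rewrite /G big_split_ord mulrDr /= !mulr_sumr.
have -> : (x ^+ Q)%:P * H.[x%:P] =
    \sum_(i < s) (x ^+ Q)%:P * ((x ^+ P)%:P * 'X^(p ^ i) + b%:P * 'X^(P - p ^ i))
    + \sum_(i < s) ((x ^+ Q) * ((x ^+ P) * (x + b / x) ^+ (p ^ (s + i))))%:P.
  rewrite -rmorph_sum -!mulr_sumr upper /H !hornerE !horner_sum -addrA mulrDr.
  congr (_ + _).
    congr (_ * _); apply: eq_bigr => i _.
    by rewrite !hornerE -polyC_exp.
  rewrite /= -mulrA polyCM; congr (_ * _).
  rewrite mulrBr polyCB -polyC_exp -polyCM (mulrC c); congr (_ - _).
  rewrite mulr_sumr rmorph_sum; apply: eq_bigr => i _ /=.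
  rewrite !hornerE -!polyC_exp -polyCM -polyCD; congr (_%:P).
  rewrite exp_term mulrDr exprD; congr (_ + _).
  by rewrite expfB_cond ?(negPf x0) ?exp_le_P // mulrCA.
apply: eqmodpD; apply: eqmodp_sum => i _.
  rewrite !mulrDr; apply: eqmodpD.
    rewrite exprD [X in eqmodp _ _ X]mulrCA; apply: eqmodpMl.
    exact/eqmodpM/eqmodp_refl.
  (* The part of the exponent divisible by [P] reduces to a power of [x], which together with [x^P]
     makes [x^Q]; the rest stays in [X]. *)
  have -> : (Q - p ^ i = P * (p ^ s' - 1) + (P - p ^ i))%N.
    rewrite mulnBr muln1 -QE; have := exp_le_P i; lia.
  have -> : (Q = P + P * (p ^ s' - 1))%N.
    rewrite mulnBr muln1 -QE; lia.
  rewrite -mul_polyC !exprD rmorphM -mulrA; apply: eqmodpMl.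
  rewrite mulrCA; apply: eqmodpM; last exact: eqmodp_refl.
  exact: eqXP.
rewrite -(mul_polyC b) exp_term !mulrDr rmorphD /=.
have le_Q : (p ^ (s + i) <= Q)%N.
  by rewrite leq_exp2l // leq_add2l -ltnS.
apply: eqmodpD.
  rewrite mulrCA rmorphM; apply: eqmodpMl.
  rewrite -exprD expnD QE -mulnDr; exact: eqXP.
rewrite [x ^+ Q * _]mulrCA rmorphM; apply: eqmodpMl.
have -> : x ^+ Q * (b / x ^+ (p ^ (s + i))) = b * x ^+ (Q - p ^ (s + i)).
  by rewrite expfB_cond ?(negPf x0) // mulrCA.
rewrite rmorphM; apply: eqmodpMl; rewrite expnD QE -mulnBr; exact: eqXP.
Qed.

(** The padding factors of exponent [p.-1 - k] make the two prefactors independent of [k], so these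
    congruences can be combined linearly over all indices. *)
Lemma stepanov_local (al j k : nat) : (k <= p.-1)%N ->
  eqmodp D
    ((x ^+ (P * p.-1))%:P * ('X^(al + j * p ^ (s + s) + Q * (p.-1 - k)) * G ^+ k))
    ((x ^+ (Q * p.-1))%:P *
       (('X^al)%:P * 'X^j * H ^+ k * 'X^(P * (p.-1 - k))).[x%:P]).
Proof.
move=> kp; rewrite !hornerM !horner_exp !hornerX hornerC.
have -> : (x ^+ (P * p.-1))%:P * ('X^(al + j * p ^ (s + s) + Q * (p.-1 - k)) * G ^+ k)
  = ('X^al * x%:P ^+ (P * (p.-1 - k))) * ('X^(p ^ (s + s)) ^+ j * ('X^Q ^+ (p.-1 - k)
      * ((x ^+ P)%:P * G) ^+ k)).
  rewrite -{1}(subnK kp) mulnDr !exprD ![(j * _)%N]mulnC ![(P * k)%N]mulnC.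
  rewrite rmorphM exprMn -!rmorphXn /= -!exprM ![(k * P)%N]mulnC.
  by ring.
have -> : x ^+ (Q * p.-1) = x ^+ (Q * (p.-1 - k)) * x ^+ (Q * k).
  by rewrite -exprD -mulnDr subnK.
rewrite [X in eqmodp _ _ X](_ : _ = ('X^al * x%:P ^+ (P * (p.-1 - k))) *
   (x%:P ^+ j * ((x ^+ Q)%:P ^+ (p.-1 - k) * ((x ^+ Q)%:P * H.[x%:P]) ^+ k))).
  apply: eqmodpMl; apply: eqmodpM; first exact: eqmodpX.
  by apply: eqmodpM; apply: eqmodpX.
rewrite rmorphM exprMn -!rmorphXn /= -!exprM; ring.
Qed.

End AtPoint.

(* The auxiliary polynomial is a combination of the [t u] below, whose degrees
   are distinct; it vanishes to order [P] at every point of the fibre. *)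
Theorem stepanov_bound :
  (#|[set x : E | (x != 0%R) && (frob_trace p (s + s) (x + b / x)%R == c)]|
     <= Q + (8 * p + 2) * P)%N.
Proof.
pose N := [set x : E | (x != 0) && (frob_trace p (s + s) (x + b / x) == c)].
rewrite -/N.
(* There are [P (P J)] unknowns and [P J = Q + 8 p P]. Each of the [P] residues carries
   [Q + 3 p P + J + 1] conditions, and the remaining [5 p P] exceeds [J + 1]. *)
pose J := (p ^ s' + 8 * p)%N.
pose U := ('I_Q * 'I_J * 'I_p)%type.
pose w (u : U) : {poly {poly E}} :=
  ('X^(u.1.1))%:P * 'X^(u.1.2) * H ^+ u.2 * 'X^(P * (p.-1 - u.2)).
have le_k (u : U) : (u.2 <= p.-1)%N by rewrite -ltnS prednK.
have box_w u : in_box (Q + P * p) (J + 2 * P * p) (w u).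
  apply: in_box_le (in_boxM (in_boxM (in_boxM (in_box_innerXn _ _)
    (in_box_outerXn _ _)) (in_boxX _ box_H)) (in_box_outerXn _ _)).
    rewrite !addn0; apply: leq_add; first exact/ltnW/ltn_ord.
    by rewrite leq_mul2l (ltnW (ltn_ord u.2)) orbT.
  rewrite add0n -addnA; apply: leq_add; first exact/ltnW/ltn_ord.
  have := le_k u; move: (nat_of_ord u.2) => k; clear -p_gt0; nia.
have [|v v0 vdvd] := combination_divisible P_gt0 box_w.
  rewrite !card_prod !card_ord.
  have -> : (Q * J * p = P * (P * J))%N by rewrite mulnAC (mulnC Q) pQ mulnA.
  rewrite ltn_pmul2l // /J [(P * (_ + _))%N]mulnDr -QE.
  nia.
pose t (u : U) : {poly E} :=
  'X^(u.1.1 + u.1.2 * p ^ (s + s) + Q * (p.-1 - u.2)) * G ^+ u.2.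
have G0 : G != 0 by rewrite -size_poly_eq0 size_G.
have t0 u : t u != 0.
  by rewrite mulf_neq0 ?expf_neq0 // -size_poly_eq0 size_polyX.
(* Since [G] has degree exactly [2 Q], the three indices are the digits of the degree in mixed radix
   [Q], [p]; this gives injectivity. *)
have size_t u : size (t u) = (u.1.1 + Q * (u.2 + p * u.1.2) + Q * p.-1).+1.
  rewrite /t qE.
  rewrite size_mul ?expf_neq0 // -?size_poly_eq0 ?size_polyX // size_polyXn.
  rewrite -(@prednK (size (G ^+ _))); last by rewrite size_poly_gt0 expf_neq0.
  rewrite size_exp size_G /= addnS /=.
  have := le_k u; move: (nat_of_ord u.2) => k hk; congr _.+1.
  by rewrite -{2}(subnK hk); lia.
have t_inj : injective (fun u => size (t u)).
  move=> [[a j] k] [[a' j'] k'] /=; rewrite !size_t /= => -[] /addIn e.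
  have ea : (nat_of_ord a = a').
    move: (congr1 (modn^~ Q) e); rewrite !(mulnC Q) (addnC a) (addnC a').
    by rewrite !modnMDl !modn_small.
  move: e; rewrite ea => /addnI /eqP; rewrite eqn_pmul2l // => /eqP e.
  have ek : (nat_of_ord k = k').
    move: (congr1 (modn^~ p) e); rewrite ![(_ + p * _)%N]addnC !(mulnC p).
    by rewrite !modnMDl !modn_small.
  move: e; rewrite ek => /addnI /eqP; rewrite eqn_pmul2l // => /eqP ej.
  by congr (_, _, _); apply: val_inj.
have R0 := sum_distinct_sizes_neq0 t0 t_inj v0.
set R := \sum_u _ in R0.
have RN x : x \in enum N -> ('X - x%:P) ^+ P %| R.
  rewrite mem_enum inE => /andP[x0 /eqP trx].
  have charP : p \in [pchar {poly E}] by rewrite pchar_poly.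
  rewrite (exprB_pchar_exp charP) -/P -rmorphXn /=.
  (* Scaling by a nonzero constant does not affect divisibility and brings in the left-hand
     prefactor of [stepanov_local]. *)
  rewrite -(dvdpZr _ _ (expf_neq0 (P * p.-1) x0)) -[_ *: R]subr0.
  apply: eqmodp_trans (_ : eqmodp _ ((x ^+ (Q * p.-1))%:P * \sum_u v u *: (w u).[x%:P]) _).
    rewrite -mul_polyC !mulr_sumr; apply: eqmodp_sum => u _.
    rewrite -!(mul_polyC (v u)) !(mulrCA _ (v u)%:P); apply: eqmodpMl.
    exact: stepanov_local.
  by rewrite /eqmodp subr0 dvdp_mull.
have := card_multiple_roots R0 (enum_uniq _) RN; rewrite -cardE => ltN.
have size_R : (size R <= (J + 2) * P * P)%N.
  apply: leq_trans (size_sum _ _ _) _; apply/bigmax_leqP => u _.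
  apply: leq_trans (size_scale_leq _ _) _; rewrite size_t -mulnA -pQ.
  case: u => [[a j] k] /=.
  have := ltn_ord a; have := ltn_ord j; have := ltn_ord k.
  move: (nat_of_ord a) (nat_of_ord j) (nat_of_ord k) => {a j k} a j k hk hj ha.
  have h : (k + p * j + p.-1 + 1 <= p * (J + 2))%N by nia.
  have -> : ((J + 2) * (p * Q) = Q * (p * (J + 2)))%N by rewrite mulnC mulnAC mulnC.
  apply: leq_trans (_ : (Q * (k + p * j + p.-1 + 1) <= _)%N); last by rewrite leq_mul2l h orbT.
  by clear -ha; lia.
have := leq_trans ltN size_R; rewrite ltn_pmul2r // => /ltnW.
by rewrite /J -addnA mulnDl mulnC -QE.
Qed.

End Stepanov.

(** * Kloosterman sums over a quadratic extension *)

Section FixedSubfield.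
Variables (E : finFieldType) (p : nat).
Hypothesis charE : p \in [pchar E].

Let p_gt1 : (1 < p)%N. Proof. exact/prime_gt1/(pcharf_prime charE). Qed.
Let p_gt0 : (0 < p)%N. Proof. exact: ltnW. Qed.

(** The copy of [F_(p^n)] inside [E] when [n] divides the degree of [E]; the whole tower lives in
    one field, without embeddings. *)
Definition frob_fix n : {set E} := [set x | x ^+ (p ^ n) == x].

Lemma frob_fixP n x : reflect (x ^+ (p ^ n) = x) (x \in frob_fix n).
Proof. by rewrite inE; apply: eqP. Qed.

Lemma frob_fix0 n : 0 \in frob_fix n.
Proof. by apply/frob_fixP; rewrite expr0n expn_eq0 -leqn0 leqNgt p_gt0. Qed.

Lemma frob_fix1 n : 1 \in frob_fix n.
Proof. by apply/frob_fixP; rewrite expr1n. Qed.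

Lemma frob_fixD n x y : x \in frob_fix n -> y \in frob_fix n -> x + y \in frob_fix n.
Proof.
by move=> /frob_fixP hx /frob_fixP hy; apply/frob_fixP; rewrite (exprD_pchar_exp charE) hx hy.
Qed.

Lemma frob_fixB n x y : x \in frob_fix n -> y \in frob_fix n -> x - y \in frob_fix n.
Proof.
by move=> /frob_fixP hx /frob_fixP hy; apply/frob_fixP; rewrite (exprB_pchar_exp charE) hx hy.
Qed.

Lemma frob_fixM n x y : x \in frob_fix n -> y \in frob_fix n -> x * y \in frob_fix n.
Proof.
by move=> /frob_fixP hx /frob_fixP hy; apply/frob_fixP; rewrite exprMn hx hy.
Qed.

Lemma frob_fixV n x : x \in frob_fix n -> x^-1 \in frob_fix n.
Proof. by move=> /frob_fixP hx; apply/frob_fixP; rewrite exprVn hx. Qed.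

Lemma frob_fix_leq1 n x : x \in frob_fix 1 -> x \in frob_fix n.
Proof. by move/frob_fixP=> hx; apply/frob_fixP/expr_pchar_fix. Qed.

Lemma size_frob_poly n : (0 < n)%N -> size ('X^(p ^ n) - 'X : {poly E}) = (p ^ n).+1.
Proof.
move=> n0; rewrite size_polyDl size_polyXn // size_polyN size_polyX ltnS.
by apply: leq_trans p_gt1 _; rewrite -{1}(expn1 p) leq_exp2l.
Qed.

(** [X^(p^n) - X] divides [X^#|E| - X], a product of distinct linear factors, so it has as many
    roots in [E] as its degree. *)
Lemma card_frob_fix n k : (0 < n)%N -> #|E| = (p ^ (n * k))%N -> #|frob_fix n| = (p ^ n)%N.
Proof.
move=> n0 card_E; set d : {poly E} := 'X^(p ^ n) - 'X.
have size_d : size d = (p ^ n).+1 := size_frob_poly n0.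
have d0 : d != 0 by rewrite -size_poly_eq0 size_d.
have d_root x : root d x = (x \in frob_fix n).
  by rewrite inE /root !hornerE subr_eq0.
apply/eqP; rewrite eqn_leq; apply/andP; split.
  rewrite -ltnS -size_d cardE; apply: max_poly_roots => //; last exact: enum_uniq.
  by apply/allP => x; rewrite mem_enum d_root.
have eqXk m : eqmodp d 'X^(p ^ (n * m)) 'X.
  elim: m => [|m IHm]; first by rewrite muln0; apply: eqmodp_refl.
  rewrite mulnSr expnD exprM; apply: eqmodp_trans (eqmodpX _ IHm) _.
  exact: dvdpp.
have := eqXk k; rewrite /eqmodp -card_E finField_genPoly => /dvdp_prod_XsubC[m dm].
have := eqp_size dm; rewrite size_d size_prod_XsubC => -[->].
rewrite cardE; apply: uniq_leq_size; first exact/mask_uniq/index_enum_uniq.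
move=> x xm; rewrite mem_enum -d_root (eqp_root dm) root_prod_XsubC; exact: xm.
Qed.

Lemma frob_traceD n (x y : E) : frob_trace p n (x + y) = frob_trace p n x + frob_trace p n y.
Proof.
by rewrite /frob_trace -big_split; apply: eq_bigr => i _; rewrite (exprD_pchar_exp charE).
Qed.

Lemma frob_trace_double n (x : E) :
  frob_trace p (n + n) x = frob_trace p n (x + x ^+ (p ^ n)).
Proof.
rewrite frob_traceD /frob_trace big_split_ord; congr (_ + _).
by apply: eq_bigr => i _; rewrite -exprM -expnD.
Qed.

Lemma frob_trace_fix n x : x \in frob_fix n -> frob_trace p n x \in frob_fix 1.
Proof.
move=> /frob_fixP hx; apply/frob_fixP.
rewrite /frob_trace (expr_sum_pchar_exp charE).
case: n hx => [|n] hx; first by rewrite !big_ord0.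
rewrite big_ord_recr /= big_ord_recl /= addrC -exprM -expnD addn1 hx expr1.
by congr (_ + _); apply: eq_bigr => i _; rewrite -exprM -expnD addn1.
Qed.

(** The trace is a polynomial of degree [p^(n-1)], too small to vanish on [p^n] points. *)
Lemma frob_trace_neq0 n : (0 < n)%N -> #|frob_fix n| = (p ^ n)%N ->
  exists2 x, x \in frob_fix n & frob_trace p n x != 0.
Proof.
case: n => // n _ cardF.
have [/existsP[x /andP[]]|] := boolP [exists x, (x \in frob_fix n.+1) && (frob_trace p n.+1 x != 0)].
  by exists x.
rewrite negb_exists => /forallP h.
pose t : {poly E} := \sum_(i < n.+1) 'X^(p ^ i).
have size_t : size t = (p ^ n).+1.
  rewrite /t big_ord_recr /= addrC size_polyDl size_polyXn // ltnS.
  apply: leq_trans (size_sum _ _ _) _; apply/bigmax_leqP => i _.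
  by rewrite size_polyXn ltn_exp2l.
suff : (#|frob_fix n.+1| < (p ^ n).+1)%N.
  by rewrite cardF ltnS leq_exp2l // ltnn.
rewrite cardE -size_t; apply: max_poly_roots; last exact: enum_uniq.
  by rewrite -size_poly_eq0 size_t.
apply/allP => x; rewrite mem_enum => hx; have := h x; rewrite hx negbK => /eqP tx.
rewrite /root /t horner_sum -[X in _ == X]tx; apply/eqP; apply: eq_bigr => i _.
by rewrite hornerXn.
Qed.

End FixedSubfield.

Lemma sum_prod_eq (F : idomainType) (x y z w : F) :
  x + y = z + w -> x * y = z * w -> (z == x) || (z == y).
Proof.
move=> hs hm; rewrite -(subr_eq0 z x) -(subr_eq0 z y) -mulf_eq0.
have -> : (z - x) * (z - y) = z * z - (x + y) * z + x * y by ring.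
by rewrite hs hm; apply/eqP; ring.
Qed.

Section Doubling.
Variables (E : finFieldType) (p : nat) (C : numFieldType) (psi : E -> C).
Hypothesis charE : p \in [pchar E].
Hypothesis psiD : {in frob_fix E p 1 &, {morph psi : x y / x + y >-> x * y}}.
Hypothesis psi_eq1 : {in frob_fix E p 1, forall x, psi x = 1 -> x = 0}.
Hypothesis psi0 : psi 0 = 1.
Variable n : nat.
Hypothesis n_gt0 : (0 < n)%N.
Let F := frob_fix E p n.
Let K := frob_fix E p (n + n).
Let q := (p ^ n)%N.
Hypothesis cardF : #|F| = q.
Hypothesis cardK : #|K| = (q * q)%N.

Definition trace_char m x := psi (frob_trace p m x).

Definition kloosterman_sum m (b : E) : C :=
  \sum_(x in frob_fix E p m | x != 0) trace_char m (x + b / x).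

Lemma trace_charD m : {in frob_fix E p m &, {morph trace_char m : x y / x + y >-> x * y}}.
Proof.
move=> x y hx hy; rewrite /trace_char (frob_traceD charE) psiD //;
  exact: (frob_trace_fix charE).
Qed.

(** Orthogonality: translating [s] by [y / t], where [y] has nonzero trace, multiplies the sum by a
    value different from 1. *)
Lemma sum_trace_char t : t \in F ->
  \sum_(s in F) trace_char n (s * t) = if t == 0 then q%:R else 0.
Proof.
move=> tF; case: eqVneq => [-> | t0].
  rewrite (eq_bigr (fun=> 1)) ?sumr_const ?cardF // => s _.
  rewrite mulr0 /trace_char /frob_trace big1 ?psi0 // => i _.
  apply/eqP; rewrite expf_eq0 eqxx andbT expn_gt0.
  by rewrite (prime_gt0 (pcharf_prime charE)).
have [y yF try] := frob_trace_neq0 charE n_gt0 cardF.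
have ytF : y / t \in F by rewrite frob_fixM ?frob_fixV.
set S := \sum_(s in F) _.
have : S = trace_char n y * S.
  rewrite {1}/S (reindex_inj (addIr (y / t))) /= mulr_sumr.
  apply: eq_big => [s|s sF].
    apply/idP/idP => h; last exact: frob_fixD.
    by rewrite -(addrK (y / t) s); apply: frob_fixB.
  have sF' : s \in F by rewrite -(addrK (y / t) s); apply: frob_fixB.
  by rewrite mulrDl divfK // trace_charD ?frob_fixM // mulrC.
move/eqP; rewrite -subr_eq0 -{1}(mul1r S) -mulrBl mulf_eq0 => /orP[|/eqP //].
rewrite subr_eq0 eq_sym => /eqP /psi_eq1 h; case/eqP: try; apply: h.
exact: (frob_trace_fix charE).
Qed.

Let pairs : {set E * E} := setX F F.
(** Relative trace and norm: up to sign, the coefficients of the quadratic with roots [x] and [x^q].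
    [beta] does the same for two roots in [F]. *)
Let alpha (x : E) := (x + x ^+ q, x * x ^+ q).
Let beta (z : E * E) := (z.1 + z.2, z.1 * z.2).

Let alpha_pairs x : x \in K -> alpha x \in pairs.
Proof.
move=> /frob_fixP; rewrite expnD exprM -/q => hx; rewrite inE /=.
apply/andP; split; apply/frob_fixP; rewrite -/q.
  by rewrite (exprD_pchar_exp charE) -/q hx addrC.
by rewrite exprMn hx mulrC.
Qed.

Let beta_pairs z : z \in pairs -> beta z \in pairs.
Proof.
by case: z => x y; rewrite !in_setX => /andP[h1 h2]; apply/andP; split; [apply: frob_fixD | apply: frob_fixM].
Qed.

Let fibers t := (#|[set x in K | alpha x == t]| + #|[set z in pairs | beta z == t]|)%N.

(** A quadratic determines its roots up to order. If it has a conjugate pair outside [F], no pair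
    from [F] occurs; a double root counts once in each fibre. *)
Let fibers_le2 t : (fibers t <= 2)%N.
Proof.
rewrite /fibers; have [-> | [x]] := set_0Vmem [set x in K | alpha x == t].
  rewrite cards0 add0n; have [-> | [[x y]]] := set_0Vmem [set z in pairs | beta z == t].
    by rewrite cards0.
  rewrite inE => /andP[_ /eqP <-].
  apply: leq_trans (subset_leq_card (_ : _ \subset [set (x, y); (y, x)])) _.
    apply/subsetP => -[z w]; rewrite !inE => /andP[_ /eqP[hs hm]].
    have := sum_prod_eq (esym hs) (esym hm) => /orP[]/eqP ez; move: hs; rewrite ez.
      by move/addrI => ->; rewrite eqxx.
    by rewrite addrC => /addIr ->; rewrite eqxx orbT.
  by rewrite cards2; case: (_ != _).
rewrite inE => /andP[xK /eqP tE].
have inA z : z \in [set x in K | alpha x == t] -> (z == x) || (z == x ^+ q).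
  rewrite inE -tE => /andP[_ /eqP[hs hm]]; exact: (sum_prod_eq (esym hs) (esym hm)).
have inB z w : (z, w) \in [set z in pairs | beta z == t] ->
    [/\ z ^+ q = z, w ^+ q = w & z + w = x + x ^+ q] /\ ((z == x) || (z == x ^+ q)).
  rewrite !inE -tE => /andP[/andP[/eqP hz /eqP hw] /eqP[hs hm]]; split; first by split.
  exact: (sum_prod_eq (esym hs) (esym hm)).
have hx2 : (x ^+ q) ^+ q = x by move/frob_fixP: xK; rewrite expnD exprM.
have [xq | xq] := eqVneq (x ^+ q) x.
  rewrite -[2%N]/(1 + 1)%N; apply: leq_add.
    rewrite -(cards1 x); apply/subset_leq_card/subsetP => z /inA.
    by rewrite xq orbb inE.
  rewrite -(cards1 (x, x)); apply/subset_leq_card/subsetP => -[z w] /inB[[_ _]].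
  by rewrite xq orbb => hs /eqP ez; move: hs; rewrite ez => /addrI ->; rewrite inE.
have -> : [set z in pairs | beta z == t] = set0.
  apply/setP => -[z w]; rewrite [RHS]inE; apply/negP => /inB[[hz _ _]].
  case/orP => /eqP ez; move: hz; rewrite ez => e; case/eqP: xq => //.
  by rewrite -{2}hx2 e.
rewrite cards0 addn0; apply: leq_trans (_ : #|[set x; x ^+ q]| <= _)%N.
  by apply/subset_leq_card/subsetP => z /inA; rewrite !inE.
by rewrite cards2; case: (_ != _).
Qed.

(** The fibres have total size [#|K| + #|F|^2 = 2 #|pairs|], so every inequality of [fibers_le2] is
    an equality. No discussion of irreducibility is needed. *)
Let fibersE t : t \in pairs -> fibers t = 2.
Proof.
have total : (\sum_(t in pairs) fibers t = \sum_(t in pairs) 2)%N.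
  rewrite big_split /= sum_nat_const cardsX cardF muln2 -addnn; congr (_ + _)%N.
    rewrite -cardK -sum1_card (partition_big alpha (mem pairs)) //=.
    by apply: eq_bigr => t' _; rewrite -sum1_card; apply: eq_bigl => x; rewrite inE.
  rewrite -cardF -cardsX -/pairs -sum1_card [RHS](partition_big beta (mem pairs)) //=.
  by apply: eq_bigr => t' _; rewrite -sum1_card; apply: eq_bigl => x; rewrite inE.
have [_] := leqif_sum (fun t (_ : t \in pairs) => leqif_eq (fibers_le2 t)).
rewrite total eqxx => /esym/forallP h tP; apply/eqP.
by have := h t; rewrite tP.
Qed.

(* The monic quadratics with coefficients in [F] are each hit twice, by the
   conjugate pairs of [K] and the ordered pairs of [F] together. *)
Lemma kloosterman_double b : b \in F -> b != 0 ->
  kloosterman_sum (n + n) b + kloosterman_sum n b ^+ 2 = (2 * q)%:R.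
Proof.
move=> bF b0.
(* For roots [x], [y] with sum [t.1] and product [t.2], [x + y + b/x + b/y = t.1 + b t.1 / t.2]. *)
pose g (t : E * E) := trace_char n (t.1 + b * t.1 / t.2).
have bq : b ^+ q = b by apply/frob_fixP.
have -> : kloosterman_sum (n + n) b = \sum_(x in K | x != 0) g (alpha x).
  apply: eq_bigr => x /andP[xK x0]; rewrite /g /alpha /trace_char (frob_trace_double charE).
  congr (psi (frob_trace p n _)); rewrite (exprD_pchar_exp charE) -/q /= expr_div_n bq.
  have xq0 : x ^+ q != 0 by rewrite expf_neq0.
  by move: (x ^+ q) xq0 => y y0; field; rewrite x0 y0.
have -> : kloosterman_sum n b ^+ 2 =
    \sum_(z in pairs | (z.1 != 0) && (z.2 != 0)) g (beta z).
  rewrite expr2 big_distrl /=; under eq_bigr => x _ do rewrite big_distrr /=.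
  rewrite pair_big /=; apply: eq_big => [[x y]|[x y]] /=.
    by rewrite in_setX /= -!andbA; do !bool_congr.
  case/andP=> /andP[xF x0] /andP[yF y0].
  rewrite -trace_charD ?frob_fixD ?frob_fixM ?frob_fixV //.
  by congr trace_char; rewrite /=; field; rewrite x0 y0.
have -> : \sum_(x in K | x != 0) g (alpha x) =
    \sum_(t in pairs | t.2 != 0) g t *+ #|[set x in K | alpha x == t]|.
  rewrite (partition_big alpha (fun t => (t \in pairs) && (t.2 != 0))) /=; last first.
    move=> x /andP[xK x0]; rewrite [_ \in _]alpha_pairs //=.
    by rewrite mulf_neq0 // expf_neq0.
  apply: eq_bigr => t /andP[_ t0]; rewrite -sumr_const; apply: eq_big => [x|x].
    rewrite [RHS]inE; case: (alpha x =P t) => [ta|_]; last by rewrite !andbF.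
    rewrite !andbT; case: eqVneq => [x0|]; last by rewrite andbT.
    by move: t0; rewrite -ta x0 /= mul0r eqxx.
  by case/andP=> _ /eqP ->.
have -> : \sum_(z in pairs | (z.1 != 0) && (z.2 != 0)) g (beta z) =
    \sum_(t in pairs | t.2 != 0) g t *+ #|[set z in pairs | beta z == t]|.
  rewrite (partition_big beta (fun t => (t \in pairs) && (t.2 != 0))) /=; last first.
    move=> x /andP[xK x0]; rewrite [_ \in _]beta_pairs //=.
    by rewrite mulf_eq0 negb_or.
  apply: eq_bigr => t /andP[_ t0]; rewrite -sumr_const; apply: eq_big => [x|x].
    rewrite [RHS]inE; case: (beta x =P t) => [ta|_]; last by rewrite !andbF.
    rewrite !andbT -negb_or -mulf_eq0.
    by move: t0; rewrite -ta /= => ->; rewrite andbT.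
  by case/andP=> _ /eqP ->.
rewrite -big_split /=.
under eq_bigr => t /andP[tP _] do rewrite -mulrnDr -/(fibers t) fibersE //.
rewrite (eq_bigl (fun t => (t.1 \in F) && ((t.2 \in F) && (t.2 != 0)))); last first.
  by move=> t; rewrite !inE andbA.
rewrite (eq_bigr (fun t => g (t.1, t.2) *+ 2)); last by case.
rewrite -(pair_big (mem F) (fun m => (m \in F) && (m != 0)) (fun s m => g (s, m) *+ 2)) /=.
rewrite exchange_big /=.
(* Summing over the first coordinate by orthogonality leaves only the product [m = -b]. *)
rewrite (eq_bigr (fun m => (if 1 + b / m == 0 then q%:R else 0) *+ 2)); last first.
  move=> m /andP[mF m0]; rewrite -sum_trace_char; last first.
    by rewrite frob_fixD ?frob_fix1 ?frob_fixM ?frob_fixV.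
  rewrite -sumrMnl; apply: eq_bigr => s _; rewrite /g /=.
  by congr (trace_char n _ *+ 2); rewrite mulrDr mulr1 mulrCA mulrA.
rewrite (bigD1 (- b)) /=; last first.
  by rewrite oppr_eq0 b0 -sub0r frob_fixB ?frob_fix0.
rewrite invrN mulrN divff // subrr eqxx big1 ?addr0 ?natrM ?mulr_natl //.
move=> m /andP[/andP[mF m0] mb]; case: eqP => [e|_]; last by rewrite mul0rn.
case/eqP: mb; apply/eqP; rewrite -addr_eq0 addrC.
have : (m + b) / m = 0 by rewrite mulrDl divff.
by move/eqP; rewrite mulf_eq0 invr_eq0 (negPf m0) orbF addrC.
Qed.

End Doubling.

(** * The bound over the prime field *)

Lemma norm_unity_root (C : numDomainType) (n : nat) (z : C) :
  (0 < n)%N -> z ^+ n = 1 -> `|z| = 1.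
Proof.
move=> n0 /(congr1 Num.norm)/eqP.
by rewrite normrX normr1 pexpr_eq1 // => /eqP.
Qed.

Section PrimeFieldEmbedding.
Variables (p : nat) (E : finFieldType).
Hypotheses (pr : prime p) (charE : p \in [pchar E]).

Definition Fp_embed (x : 'F_p) : E := (x : nat)%:R.

Lemma Fp_embedD x y : Fp_embed (x + y) = Fp_embed x + Fp_embed y.
Proof. by rewrite /Fp_embed /= [X in (_ %% X)%N]Fp_cast // (GRing.natr_mod_pchar charE) natrD. Qed.

Lemma Fp_embedM x y : Fp_embed (x * y) = Fp_embed x * Fp_embed y.
Proof. by rewrite /Fp_embed /= [X in (_ %% X)%N]Fp_cast // (GRing.natr_mod_pchar charE) natrM. Qed.

Lemma Fp_embed0 : Fp_embed 0 = 0. Proof. by []. Qed.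

Lemma Fp_embed1 : Fp_embed 1 = 1.
Proof. by rewrite /Fp_embed /= modn_small. Qed.

Lemma Fp_embed_eq0 x : (Fp_embed x == 0) = (x == 0).
Proof.
rewrite -(dvdn_pcharf charE) -val_eqE /=.
have xp : (x < p)%N by rewrite -{2}(Fp_cast pr).
apply/idP/eqP => [/dvdnP[[|k] e] | ->]; rewrite ?dvdn0 //.
by move: xp; rewrite e mulSn ltnNge leq_addr.
Qed.

Lemma Fp_embed_inj : injective Fp_embed.
Proof.
move=> x y e; apply/eqP; rewrite -subr_eq0 -Fp_embed_eq0.
by apply/eqP/(addIr (Fp_embed y)); rewrite -Fp_embedD subrK add0r.
Qed.

Lemma Fp_embedV x : Fp_embed x^-1 = (Fp_embed x)^-1.
Proof.
have [-> | x0] := eqVneq x 0; first by rewrite invr0 Fp_embed0 invr0.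
apply: (mulfI (_ : Fp_embed x != 0)); first by rewrite Fp_embed_eq0.
by rewrite -Fp_embedM !divff ?Fp_embed1 // Fp_embed_eq0.
Qed.

Lemma Fp_embed_fix x : Fp_embed x \in frob_fix E p 1.
Proof.
have eX n : Fp_embed (x ^+ n) = Fp_embed x ^+ n.
  by elim: n => [|n IHn]; rewrite ?Fp_embed1 // !exprS Fp_embedM IHn.
by apply/frob_fixP; rewrite expn1 -eX -{2}(expf_card x) card_Fp.
Qed.

Hypothesis cardF1 : #|frob_fix E p 1| = p.

Lemma frob_fix1E : frob_fix E p 1 = [set Fp_embed x | x in 'F_p].
Proof.
apply/esym/eqP; rewrite eqEcard cardF1 card_imset; last exact: Fp_embed_inj.
rewrite card_Fp // leqnn andbT; apply/subsetP => _ /imsetP[x _ ->].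
exact: Fp_embed_fix.
Qed.

Variables (C : numFieldType) (zeta : C).
Hypotheses (zetap : zeta ^+ p = 1) (zeta1 : zeta != 1).

Lemma Fp_prim_root : p.-primitive_root zeta.
Proof.
have [m mz] := prim_order_exists (prime_gt0 pr) zetap.
case/primeP: pr => _ /[apply] /orP[/eqP m1|/eqP <- //].
by case/eqP: zeta1; move/prim_expr_order: mz; rewrite m1 expr1.
Qed.

(** The default 1 outside the prime field keeps all values of modulus 1, as [kloosterman_sum_top]
    requires. *)
Definition Fp_char (y : E) : C :=
  if [pick x | Fp_embed x == y] is Some x then zeta ^+ x else 1.

Lemma Fp_charE x : Fp_char (Fp_embed x) = zeta ^+ x.
Proof.
rewrite /Fp_char; case: pickP => [z /eqP/Fp_embed_inj -> //|/(_ x)].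
by rewrite eqxx.
Qed.

Lemma norm_Fp_char y : `|Fp_char y| = 1.
Proof.
rewrite /Fp_char; case: pickP => [x _|]; last by rewrite normr1.
by rewrite normrX (norm_unity_root (prime_gt0 pr) zetap) expr1n.
Qed.

Lemma expr_FpD (x y : 'F_p) : zeta ^+ (x + y)%R = zeta ^+ x * zeta ^+ y.
Proof. by rewrite /= [X in (_ %% X)%N]Fp_cast // expr_mod // exprD. Qed.

Lemma Fp_charD : {in frob_fix E p 1 &, {morph Fp_char : x y / x + y >-> x * y}}.
Proof.
rewrite frob_fix1E => _ _ /imsetP[x _ ->] /imsetP[y _ ->].
by rewrite -Fp_embedD !Fp_charE expr_FpD.
Qed.

Lemma Fp_char_eq1 : {in frob_fix E p 1, forall x, Fp_char x = 1 -> x = 0}.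
Proof.
rewrite frob_fix1E => _ /imsetP[x _ ->]; rewrite Fp_charE => /eqP.
rewrite -(prim_order_dvd Fp_prim_root) (dvdn_pcharf charE) => /eqP; exact.
Qed.

Lemma Fp_char0 : Fp_char 0 = 1.
Proof. by rewrite -Fp_embed0 Fp_charE. Qed.

Lemma kloosterman_sum_Fp (b : 'F_p) :
  kloosterman_sum p Fp_char 1 (Fp_embed b) =
  \sum_(x : 'F_p | x != 0) zeta ^+ (x + b / x)%R.
Proof.
rewrite /kloosterman_sum frob_fix1E big_mkcondr big_imset /=; last first.
  by move=> x y _ _; apply: Fp_embed_inj.
rewrite [RHS]big_mkcond; apply: eq_bigr => x _; rewrite Fp_embed_eq0.
rewrite /trace_char /frob_trace big_ord1 expr1 -Fp_embedV -Fp_embedM -Fp_embedD.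
by rewrite Fp_charE.
Qed.

End PrimeFieldEmbedding.

Section KloostermanTop.
Variables (p s' : nat) (E : finFieldType) (C : numFieldType) (psi : E -> C) (b : E).
Let s := s'.+1.
Hypotheses (charE : p \in [pchar E]) (card_E : #|E| = (p ^ (s + s))%N).
Hypothesis psiD : {in frob_fix E p 1 &, {morph psi : x y / x + y >-> x * y}}.
Hypothesis psi_eq1 : {in frob_fix E p 1, forall x, psi x = 1 -> x = 0}.
Hypothesis psi0 : psi 0 = 1.
Hypothesis psi_norm : forall x, `|psi x| = 1.
Hypothesis bF : b \in frob_fix E p 1.

(** Since [psi] sums to 0 over the prime field, the Stepanov bound [M] can be subtracted from each
    fibre size [N c]. All [M - N c] are nonnegative and add up to [p M - (q - 1)], where the main
    terms cancel. *)
Lemma kloosterman_sum_top :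
  `|kloosterman_sum p psi (s + s) b| <= (p * ((8 * p + 2) * p ^ s) + 1)%:R.
Proof.
have p0 : (0 < p)%N by exact/prime_gt0/(pcharf_prime charE).
have cardF1 : #|frob_fix E p 1| = p.
  by rewrite (card_frob_fix charE _ (_ : _ = p ^ (1 * (s + s)))%N) ?mul1n.
have fixT x : x \in frob_fix E p (s + s) by apply/frob_fixP; rewrite -card_E expf_card.
set F1 := frob_fix E p 1 in cardF1 *.
pose f x := frob_trace p (s + s) (x + b / x).
pose N c := #|[set x : E | (x != 0) && (f x == c)]|.
pose M := (p ^ (s + s') + (8 * p + 2) * p ^ s)%N.
have NM c : (N c <= M)%N.
  by apply: stepanov_bound => //; move/frob_fixP: bF; rewrite expn1.
have sum_psi : \sum_(c in F1) psi c = 0.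
  have := sum_trace_char charE psiD psi_eq1 psi0 (ltnSn 0) (etrans cardF1 (esym (expn1 p))) (frob_fix1 E p 1).
  rewrite oner_eq0 => e; rewrite -[RHS]e. apply: eq_bigr => c _.
  by rewrite mulr1 /trace_char /frob_trace big_ord1 expr1.
have sum_N : (\sum_(c in F1) N c = p ^ (s + s) - 1)%N.
  rewrite -card_E subn1 -(cardC1 (0 : E)) -sum1_card [RHS](partition_big f (mem F1)) /=; last first.
    by move=> x _; apply: (frob_trace_fix charE).
  by apply: eq_bigr => c _; rewrite /N -sum1_card; apply: eq_bigl => x; rewrite !inE.
have -> : kloosterman_sum p psi (s + s) b = \sum_(c in F1) ((N c)%:R - M%:R) * psi c.
  under [RHS]eq_bigr => c _ do rewrite mulrBl.
  rewrite sumrB -mulr_sumr sum_psi mulr0 subr0 /kloosterman_sum.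
  rewrite (partition_big f (mem F1)) /=; last first.
    by move=> x _; apply: (frob_trace_fix charE).
  apply: eq_bigr => c _; rewrite mulr_natl /N -sumr_const; apply: eq_big => [x|x].
    by rewrite fixT inE.
  by case/andP=> _ /eqP <-.
apply: le_trans (ler_norm_sum _ _ _) _.
rewrite (eq_bigr (fun c => (M - N c)%:R)); last first.
  move=> c _; rewrite normrM psi_norm mulr1 distrC -natrB //.
  by rewrite ger0_norm ?ler0n.
rewrite -natr_sum ler_nat.
have -> : (\sum_(c in F1) (M - N c) = p * M - (p ^ (s + s) - 1))%N.
  rewrite -sum_N -[X in (_ = X * _ - _)%N]cardF1 -sum_nat_const.
  by rewrite sumnB // => c _; apply: NM.
have : (p * p ^ (s + s') = p ^ (s + s))%N by rewrite -expnS -addnS.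
rewrite /M mulnDr => ->; move: (p * _)%N => k; have : (0 < p ^ (s + s))%N by rewrite expn_gt0 p0.
lia.
Qed.

End KloostermanTop.

Section KloostermanBound.
Variables (p : nat) (C : numFieldType) (zeta : C).
Hypotheses (pr : prime p) (zetap : zeta ^+ p = 1) (zeta1 : zeta != 1).

(* [|S_2n| >= |S_n|^2 - 2 p^n]: normalised by [p^(n/2)], a value above [3] would
   grow beyond the bound of [kloosterman_sum_top] along [n = 2^m]. *)
Theorem kloosterman_bound (b : 'F_p) : b != 0 ->
  `|\sum_(x : 'F_p | x != 0) zeta ^+ (x + b / x)%R| ^+ 2 <= (9 * p)%:R.
Proof.
move=> b0; set K := \sum_(x | _) _.
rewrite real_leNgt ?rpredX ?normr_real ?realn //; apply/negP => big_K.
(* [kloosterman_sum_top] with [s = 2^M] gives at most [M p^s + 1], while [M] steps of growth give at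
   least [(7 + M) p^s]. *)
pose M := (8 * p ^ 2 + 2 * p)%N.
have [E charE card_E] := pPrimePowerField pr (expn_gt0 2 M.+1).
have cardF m : (m <= M.+1)%N -> #|frob_fix E p (2 ^ m)| = (p ^ 2 ^ m)%N.
  move=> mM; apply: (card_frob_fix charE (k := 2 ^ (M.+1 - m))); first by rewrite expn_gt0.
  by rewrite -expnD subnKC.
have cardF1 : #|frob_fix E p 1| = p by have := cardF 0 isT; rewrite expn0 expn1.
pose psi := @Fp_char p E C zeta; pose be := Fp_embed E b.
have psiD := Fp_charD pr charE cardF1 zetap.
have psi_eq1 := Fp_char_eq1 pr charE cardF1 zetap zeta1.
have psi0 := Fp_char0 pr charE zeta.
have beF := Fp_embed_fix pr charE b.
have be0 : be != 0 by rewrite Fp_embed_eq0.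
pose S n := kloosterman_sum p psi n be.
have doubling m : (m <= M)%N -> S (2 ^ m.+1)%N = (2 * p ^ 2 ^ m)%:R - S (2 ^ m)%N ^+ 2.
  move=> mM; apply/eqP; rewrite eq_sym subr_eq eq_sym expnS mul2n -addnn.
  apply/eqP/(kloosterman_double charE psiD psi_eq1 psi0) => //.
  - by rewrite expn_gt0.
  - by apply: cardF; apply: leqW.
  - by rewrite -expnD addnn -mul2n -expnS; apply: cardF.
  - exact: frob_fix_leq1.
have lower m : (m <= M)%N -> `|S (2 ^ m)%N| ^+ 2 - (2 * p ^ 2 ^ m)%:R <= `|S (2 ^ m.+1)%N|.
  move=> mM; rewrite doubling // distrC -normrX.
  by apply: le_trans (lerB_dist _ _); rewrite lerD2l lerN2 ger0_norm ?ler0n.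
(* The start is [9 - 2 = 7], and each step uses only [(7 + m)^2 - 2 >= 8 + m]. *)
have growth m : (m <= M)%N -> ((7 + m) * p ^ 2 ^ m)%:R <= `|S (2 ^ m.+1)%N|.
  elim: m => [|m IHm] mM.
    apply: le_trans (lower _ mM); rewrite lerBrDr -natrD addn0 expn0 expn1 -mulnDl.
    by rewrite /S kloosterman_sum_Fp // -/K ltW.
  apply: le_trans (lower _ mM); rewrite lerBrDr.
  have := IHm (ltnW mM); rewrite -(ler_pXn2r (ltn0Sn 1)) ?nnegrE ?ler0n //.
  apply: le_trans; rewrite -natrX -natrD ler_nat expnMn -expnM -expnSr -mulnDl.
  by rewrite leq_mul2r; apply/orP; right; nia.
have := growth M (leqnn _).
have s'P : (2 ^ M = (2 ^ M).-1.+1)%N by rewrite prednK ?expn_gt0.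
have card_E' : #|E| = (p ^ ((2 ^ M).-1.+1 + (2 ^ M).-1.+1))%N.
  by rewrite -s'P card_E expnS mul2n addnn.
have := kloosterman_sum_top charE card_E' psiD psi_eq1 psi0 (norm_Fp_char pr zetap) beF.
rewrite -s'P addnn -mul2n -expnS -/(S _) => h1 /le_trans/(_ h1); rewrite ler_nat.
have : (0 < p ^ 2 ^ M)%N by rewrite expn_gt0 prime_gt0.
rewrite /M; move: (p ^ _)%N => k; clear; nia.
Qed.

End KloostermanBound.

(** * Completion of the discrepancy *)

Section Completion.
Variables (p : nat) (C : numFieldType) (zeta : C).
Hypotheses (pr : prime p) (zetap : zeta ^+ p = 1) (zeta1 : zeta != 1).

Definition Fp_exp (x : 'F_p) : C := zeta ^+ nat_of_ord x.
Local Notation e := Fp_exp.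

Let eD (x y : 'F_p) : e (x + y) = e x * e y.
Proof. exact: expr_FpD. Qed.

Lemma Fp_exp0 : e 0 = 1.
Proof. exact: expr0. Qed.

Lemma Fp_exp_natr n : e n%:R = zeta ^+ n.
Proof. by rewrite /Fp_exp val_Fp_nat // expr_mod. Qed.

Lemma norm_Fp_exp x : `|e x| = 1.
Proof. by rewrite normrX (norm_unity_root (prime_gt0 pr) zetap) expr1n. Qed.

Lemma sum_Fp_exp (t : 'F_p) :
  \sum_(x : 'F_p) e (x * t) = if t == 0 then p%:R else 0.
Proof.
case: eqVneq => [-> | t0].
  under eq_bigr => x _ do rewrite mulr0 Fp_exp0.
  by rewrite sumr_const card_Fp.
set S := \sum_x _.
have : S = zeta * S.
  rewrite {1}/S (reindex_inj (addIr t^-1)) mulr_sumr; apply: eq_bigr => x _.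
  by rewrite mulrDl mulVf // eD mulrC -[1 : 'F_p]/(1%:R) Fp_exp_natr expr1.
move/eqP; rewrite -subr_eq0 -{1}(mul1r S) -mulrBl mulf_eq0 subr_eq0 eq_sym.
by rewrite (negPf zeta1) => /eqP.
Qed.

Definition Fp_fourier (I : {set 'F_p}) (u : 'F_p) : C := \sum_(x in I) e (- (u * x)).

(** Frequency 0 is left out because it produces the expected count [#|I| #|J| / p]. *)
Definition Fp_fourier_l1 I := \sum_(u | u != 0) `|Fp_fourier I u|.

Lemma Fp_fourier0 I : Fp_fourier I 0 = #|I|%:R.
Proof.
rewrite /Fp_fourier; under eq_bigr => x _ do rewrite mul0r oppr0 Fp_exp0.
by rewrite sumr_const.
Qed.

Lemma Fp_fourier_inversion I x :
  \sum_u Fp_fourier I u * e (u * x) = if x \in I then p%:R else 0.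
Proof.
under eq_bigr => u _ do rewrite mulr_suml.
rewrite exchange_big /=.
under eq_bigr => y _.
  under eq_bigr => u _ do rewrite -eD addrC -mulrBr.
  rewrite sum_Fp_exp subr_eq0; over.
rewrite -big_mkcondr /=; case: ifP => xI.
  rewrite (big_pred1 x) // => y; rewrite [RHS]eq_sym; case: eqP => [<-|]; rewrite ?xI ?andbF //.
by rewrite big_pred0 // => y; case: eqP => [<-|]; rewrite ?xI ?andbF.
Qed.

(** In the double Fourier expansion the frequency [(0, 0)] cancels the expected count. Frequencies
    with exactly one zero entry vanish, since [sigma] permutes the field. *)
Lemma discrepancy_completion (sigma : 'F_p -> 'F_p) (I J : {set 'F_p}) (B : C) :
  injective sigma ->
  (forall u v, u != 0 -> v != 0 -> `|\sum_x e (u * x + v * sigma x)| <= B) ->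
  `|#|[set x in I | sigma x \in J]|%:R - (#|I| * #|J|)%:R / p%:R|
    <= B * Fp_fourier_l1 I * Fp_fourier_l1 J / p%:R ^+ 2.
Proof.
move=> sigma_inj hB.
pose T u v := \sum_x e (u * x + v * sigma x).
have pR : 0 < p%:R :> C by rewrite ltr0n prime_gt0.
have full : \sum_u \sum_v Fp_fourier I u * Fp_fourier J v * T u v =
    p%:R ^+ 2 * #|[set x in I | sigma x \in J]|%:R.
  have -> : \sum_u \sum_v Fp_fourier I u * Fp_fourier J v * T u v =
    \sum_x (\sum_u Fp_fourier I u * e (u * x)) * (\sum_v Fp_fourier J v * e (v * sigma x)).
    under [RHS]eq_bigr => x _ do rewrite mulr_suml.
    rewrite [RHS]exchange_big; apply: eq_bigr => u _ /=.
    under [RHS]eq_bigr => x _ do rewrite mulr_sumr.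
    rewrite [RHS]exchange_big; apply: eq_bigr => v _ /=.
    rewrite /T mulr_sumr; apply: eq_bigr => x _; rewrite eD; ring.
  under eq_bigr => x _ do rewrite !Fp_fourier_inversion.
  rewrite -sum1_card natr_sum mulr_sumr [RHS]big_mkcond; apply: eq_bigr => x _.
  by rewrite inE; case: (x \in I); case: (_ \in J); rewrite /= ?mul0r ?mulr0 ?mulr1 ?expr2.
have T0 v : v != 0 -> T 0 v = 0.
  move=> v0; have := sum_Fp_exp v; rewrite (negPf v0) (reindex_inj sigma_inj) /= => h.
  by rewrite -[RHS]h; apply: eq_bigr => x _; rewrite mul0r add0r mulrC.
have T1 u : u != 0 -> T u 0 = 0.
  move=> u0; have := sum_Fp_exp u; rewrite (negPf u0) => h.
  by rewrite -[RHS]h; apply: eq_bigr => x _; rewrite mul0r addr0 mulrC.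
have T00 : T 0 0 = p%:R.
  rewrite /T; under eq_bigr => x _ do rewrite !mul0r addr0 Fp_exp0.
  by rewrite sumr_const card_Fp.
have main : p%:R ^+ 2 * (#|[set x in I | sigma x \in J]|%:R - (#|I| * #|J|)%:R / p%:R) =
    \sum_(u | u != 0) \sum_(v | v != 0) Fp_fourier I u * Fp_fourier J v * T u v.
  rewrite mulrBr -full (bigD1 0) //= (bigD1 0) //= [X in _ + X + _ - _]big1 ?addr0; last first.
    by move=> v v0; rewrite T0 // mulr0.
  rewrite T00 !Fp_fourier0 natrM [X in X - _]addrC.
  have -> : p%:R ^+ 2 * (#|I|%:R * #|J|%:R / p%:R) = #|I|%:R * #|J|%:R * p%:R :> C.
    by field; rewrite lt0r_neq0.
  rewrite addrK; apply: eq_bigr => u u0; rewrite (bigD1 0) //= T1 // mulr0 add0r //.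
rewrite ler_pdivlMr ?exprn_gt0 // mulrC -[X in X * _]ger0_norm ?exprn_ge0 ?(ltW pR) //.
rewrite -normrM main /Fp_fourier_l1 -mulrA mulr_suml mulr_sumr.
apply: le_trans (ler_norm_sum _ _ _) _; apply: ler_sum => u u0.
rewrite !mulr_sumr; apply: le_trans (ler_norm_sum _ _ _) _; apply: ler_sum => v v0.
rewrite !normrM mulrC; apply: ler_wpM2r; first by rewrite mulr_ge0.
exact: hB.
Qed.

Lemma Fp_fourier_progression (k : 'F_p) (m : nat) (u : 'F_p) : u != 0 ->
  `|Fp_fourier [set x | [exists i : 'I_m, x == k + i%:R]] u| * `|1 - e u| <= 2.
Proof.
move=> u0; set I := [set x | _].
(* [is_interval] puts no bound on [m]: a progression of length at least [p] is everything and its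
   coefficient vanishes. A shorter one has distinct points and gives a geometric sum. *)
have [pm | mp] := leqP p m.
  have -> : I = setT.
    apply/setP => x; rewrite !inE; apply/existsP.
    have xm : (nat_of_ord (x - k)%R < m)%N.
      by apply: leq_trans pm; rewrite -[X in (_ < X)%N](Fp_cast pr) ltn_ord.
    by exists (Ordinal xm); rewrite [X in k + X](natr_Zp (x - k)) addrC subrK.
  have := sum_Fp_exp (- u); rewrite oppr_eq0 (negPf u0) => h.
  rewrite /Fp_fourier (eq_bigr (fun x => e (x * - u))); last first.
    by move=> x _; rewrite mulrN mulrC.
  by rewrite (eq_bigl predT) => [|x]; rewrite ?inE // h normr0 mul0r ler0n.
have inj : injective (fun i : 'I_m => k + i%:R : 'F_p).
  move=> i j /addrI /(congr1 (@nat_of_ord _)); rewrite !val_Fp_nat // !modn_small.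
  - exact: val_inj.
  - exact: ltn_trans mp.
  - exact: ltn_trans mp.
have IE : I = [set k + (nat_of_ord i)%:R | i : 'I_m].
  apply/setP => x; rewrite inE; apply/existsP/imsetP => -[j].
    by move/eqP=> ->; exists j.
  by move=> _ ->; exists j.
rewrite /Fp_fourier IE big_imset /=; last by move=> ? ? _ _; apply: inj.
have eN n : e (- (u * n%:R)) = e (- u) ^+ n.
  elim: n => [|n IHn]; first by rewrite mulr0 oppr0 Fp_exp0.
  by rewrite exprSr -IHn -eD -natr1 mulrDr mulr1 opprD.
under eq_bigr => i _ do rewrite mulrDr opprD eD eN.
rewrite -mulr_sumr normrM norm_Fp_exp mul1r.
have -> : `|1 - e u| = `|e (- u) - 1|.
  have <- : e u * (e (- u) - 1) = 1 - e u by rewrite mulrBr mulr1 -eD subrr Fp_exp0.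
  by rewrite normrM norm_Fp_exp mul1r.
rewrite mulrC -normrM -subrX1; apply: le_trans (ler_normB _ _) _.
by rewrite normrX norm_Fp_exp expr1n normr1 -[1 + 1]/(1 *+ 2).
Qed.

(** Replacing [u x] by [x] gives the Kloosterman sum with [b = u v a], at most [3 r]; the point 0
    adds [1 <= r]. *)
Lemma twisted_sum_bound (a : 'F_p) (r : C) : a != 0 -> 0 <= r -> r ^+ 2 = p%:R ->
  forall u v, u != 0 -> v != 0 ->
  `|\sum_x e (u * x + v * (if x == 0 then 0 else a / x))| <= 4 * r.
Proof.
move=> a0 r0 r2 u v u0 v0; rewrite (bigD1 0) //= ?eqxx !mulr0 addr0 Fp_exp0.
have r1 : 1 <= r.
  rewrite -(ler_pXn2r (ltn0Sn 1)) ?nnegrE ?ler01 // expr1n r2 ler1n prime_gt0 //.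
apply: le_trans (ler_normD _ _) _; rewrite normr1.
have -> : \sum_(x | x != 0) e (u * x + v * (if x == 0 then 0 else a / x)) =
    \sum_(x : 'F_p | x != 0) e (x + (u * v * a) / x).
  rewrite [RHS](reindex_inj (mulfI u0)) /=; apply: eq_big => [x|x x0].
    by rewrite mulf_eq0 (negPf u0).
  by rewrite (negPf x0); congr Fp_exp; congr (_ + _);
    rewrite -(mulrA u) -mulf_div divff // mul1r mulrA.
have : `|\sum_(x : 'F_p | x != 0) e (x + (u * v * a) / x)| <= 3 * r.
  rewrite -(ler_pXn2r (ltn0Sn 1)) ?nnegrE ?mulr_ge0 ?ler0n // exprMn r2 -natrX -natrM.
  by apply: kloosterman_bound => //; rewrite !mulf_neq0.
move=> h; apply: le_trans (lerD r1 h) _.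
by rewrite -{1}(mul1r r) -mulrDl -[1]/(1%:R) -natrD.
Qed.

End Completion.

(** * Intervals *)

Section RealEstimates.
Local Open Scope R_scope.

(** From [sin x >= x - x^3/6], whose excess over [x/3] is [x (4 - x^2) / 6]. *)
Lemma sin_ge_third (x : R) : 0 <= x <= 2 -> x / 3 <= sin x.
Proof.
move=> [x0 x2]; have pi2 := PI2_1.
have [|h _] := sin_bound x 0 x0; first lra.
apply: Rle_trans h; rewrite /sin_approx /sin_term /=.
have : 0 <= x * (4 - x * x) by nra.
lra.
Qed.

(** The sine is symmetric about [PI/2], so the smaller of [u] and [n - u] may be used; [2/3] comes
    from [PI / 3] and [PI > 2]. *)
Lemma sin_PI_frac_ge (u n : R) : 0 < u < n ->
  2 / 3 * (u / n) <= sin (PI * (u / n)) \/ 2 / 3 * ((n - u) / n) <= sin (PI * (u / n)).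
Proof.
move=> [u0 un]; have pi2 := PI2_1; have pi4 := PI_4.
have n0 : 0 < n by lra.
have half v : 0 < v -> v <= n / 2 -> 2 / 3 * (v / n) <= sin (PI * (v / n)).
  move=> v0 vn.
  have vn0 : 0 < v / n by apply: Rdiv_lt_0_compat.
  have vn2 : v / n <= 1 / 2.
    have e : v / n * n = v by rewrite /Rdiv Rmult_assoc Rinv_l; lra.
    nra.
  apply: Rle_trans (sin_ge_third _); nra.
case: (Rle_lt_dec u (n / 2)) => h; [left; exact: half | right].
rewrite -(sin_PI_x (PI * (u / n))).
have -> : PI - PI * (u / n) = PI * ((n - u) / n).
  by rewrite Rdiv_minus_distr Rdiv_diag; lra.
apply: half; lra.
Qed.

(** This is [1 + y <= exp y] at [y = -1/(x + 1)], after taking logarithms. *)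
Lemma inv_succ_le_ln (x : R) : 0 < x -> / (x + 1) <= ln (x + 1) - ln x.
Proof.
move=> x0; have y0 : 0 < / (x + 1) by apply: Rinv_0_lt_compat; lra.
have := exp_ineq1_le (- / (x + 1)).
have -> : 1 + - / (x + 1) = x / (x + 1).
  have : (x + 1) * / (x + 1) = 1 by apply: Rinv_r; lra.
  rewrite /Rdiv; lra.
have xy : 0 < x / (x + 1) by apply: Rdiv_lt_0_compat; lra.
move=> h; have : ln (x / (x + 1)) <= - / (x + 1).
  by rewrite -[X in _ <= X]ln_exp; case: h => [h|->]; [left; apply: ln_increasing | right].
rewrite /Rdiv ln_mult // ln_Rinv; lra.
Qed.

End RealEstimates.

Lemma harmonic_le (n : nat) :
  \sum_(i < n.+1) (i.+1)%:R^-1 <= 1 + ln (n.+1)%:R :> R.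
Proof.
elim: n => [|n IHn]; first by rewrite big_ord1 invr1 ln_1 addr0.
rewrite big_ord_recr /=; apply: le_trans (lerD IHn (lexx _)) _.
rewrite -addrA lerD2l -lerBrDl.
have /RleP : Rle (Rinv (Rplus (n.+1)%:R R1)) (Rminus (ln (Rplus (n.+1)%:R R1)) (ln (n.+1)%:R)).
  by apply: inv_succ_le_ln; apply/RltP; rewrite ltr0Sn.
by rewrite RinvE RminusE RplusE -[R1]/(1 : R) natr1.
Qed.

(** Serves to absorb the 1 of [1 + ln p] into [2 ln p]. *)
Lemma ln_ge_half (n : nat) : (1 < n)%N -> 2^-1 <= ln n%:R :> R.
Proof.
move=> n1; apply/RleP; apply: Rle_trans (Rlt_le _ _ ln_lt_2) _.
have : Rle 2 (n%:R : R) by apply/RleP; rewrite -[IZR 2]/(2%:R : R) ler_nat.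
case => [h|<-]; last exact: Rle_refl.
by left; apply: ln_increasing => //; apply: Rlt_0_2.
Qed.

Local Open Scope complex_scope.

Section ComplexRoot.
Variable n : nat.

Definition unit_root : R[i] := cos (2 * PI / n%:R)%R +i* sin (2 * PI / n%:R)%R.

Lemma unit_rootX k : unit_root ^+ k =
  cos (2 * PI / n%:R * k%:R)%R +i* sin (2 * PI / n%:R * k%:R)%R.
Proof.
elim: k => [|k IHk]; first by rewrite expr0 mulr0 cos_0 sin_0.
rewrite exprSr IHk -(natr1 k) mulrDr mulr1 cos_plus sin_plus.
by rewrite /unit_root; simpc; congr Complex; apply: addrC.
Qed.

Lemma unit_root_exp : (0 < n)%N -> unit_root ^+ n = 1.
Proof.
move=> n0; rewrite unit_rootX divfK; last by rewrite pnatr_eq0 -lt0n.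
by rewrite -[2 * PI]/(Rmult 2 PI) cos_2PI sin_2PI.
Qed.

(** The chord formula, checked on squares; [k <= n] makes the sine nonnegative. *)
Lemma norm_1B_unit_root k : (0 < n)%N -> (k <= n)%N ->
  `|1 - unit_root ^+ k| = (2 * sin (PI * (k%:R / n%:R))%R)%:C.
Proof.
move=> n0 kn.
have nR : (n%:R : R) != 0 by rewrite pnatr_eq0 -lt0n.
set x := PI * _.
have sx : 0 <= sin x.
  apply/RleP; apply: sin_ge_0; apply/RleP.
    by rewrite mulr_ge0 ?divr_ge0 ?ler0n //; apply/RleP/Rlt_le/PI_RGT_0.
  rewrite -[X in _ <= X]mulr1; apply: ler_wpM2l; first exact/RleP/Rlt_le/PI_RGT_0.
  by rewrite ler_pdivrMr ?mul1r ?ler_nat // ltr0n.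
apply/eqP; rewrite -(eqrXn2 (ltn0Sn 1)) //; last by rewrite ler0c mulr_ge0 // ler0n.
rewrite -add_Re2_Im2 unit_rootX -rmorphXn /=.
have -> : 2 * PI / n%:R * k%:R = 2 * x by rewrite /x; field.
rewrite -[cos _]/(cos (Rmult 2 x)) -[sin _]/(sin (Rmult 2 x)).
rewrite cos_2a_sin sin_2a.
have h : sin x * sin x + cos x * cos x = 1 by exact: sin2_cos2.
apply/eqP; congr (_%:C); move: h; move: (sin x) (cos x) => y z h.
rewrite -[LHS]/((1 - (1 - 2 * y * y)) ^+ 2 + (0 - 2 * y * z) ^+ 2).
have -> : (1 - (1 - 2 * y * y)) ^+ 2 + (0 - 2 * y * z) ^+ 2 =
    (2 * y) ^+ 2 * (y * y + z * z) by ring.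
by rewrite h mulr1.
Qed.

End ComplexRoot.

Lemma norm_real_complex (x : R) : `|x%:C| = `|x|%:C.
Proof. by rewrite normc_def /= expr0n addr0 sqrtr_sqr. Qed.

Section Interval.
Variable p : nat.
Hypothesis pr : prime p.
Let zeta := unit_root p.

Let zetap : zeta ^+ p = 1. Proof. exact/unit_root_exp/prime_gt0. Qed.

Let Fp_ltn (u : 'F_p) : (u < p)%N.
Proof. by rewrite -[X in (_ < X)%N](Fp_cast pr) ltn_ord. Qed.

Let sin_ge k : (0 < k < p)%N ->
  2 / 3 * (k%:R / p%:R) <= sin (PI * (k%:R / p%:R))%R \/
  2 / 3 * ((p - k)%:R / p%:R) <= sin (PI * (k%:R / p%:R))%R.
Proof.
case/andP=> k0 kp.
have [|h|h] := @sin_PI_frac_ge k%:R p%:R.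
- by split; apply/RltP; rewrite ?ltr0n ?ltr_nat.
- by left; apply/RleP.
by right; rewrite natrB 1?ltnW //; apply/RleP.
Qed.

Lemma unit_root_neq1 : zeta != 1.
Proof.
have p1 := prime_gt1 pr.
have /eqP := norm_1B_unit_root (prime_gt0 pr) (prime_gt0 pr).
rewrite expr1 -/zeta => h; apply/negP => /eqP z1.
move: h; rewrite z1 subrr normr0 => /eqP [] /eqP.
rewrite eq_sym mulf_eq0 pnatr_eq0 /= => /eqP s0.
have := @sin_ge 1 p1; rewrite s0.
have pos v : (0 < v)%N -> (2 / 3 * (v%:R / p%:R) <= 0 :> R) = false.
  move=> v0; apply/negbTE; rewrite -ltNge.
  by do 2?[apply: mulr_gt0]; rewrite ?invr_gt0 ltr0n ?(prime_gt0 pr).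
by case; rewrite pos ?subn_gt0.
Qed.

(** The geometric sum bound is divided by [2 sin (PI u / p)], which inverts the [2/3] of the sine
    bound. Adding both reciprocals covers either of its alternatives. *)
Lemma Fp_fourier_interval_bound (I : {set 'F_p}) (u : 'F_p) : is_interval I -> u != 0 ->
  `|Fp_fourier zeta I u| <=
    (3 / 2 * p%:R * ((u : nat)%:R^-1 + ((- u)%R : nat)%:R^-1))%:C.
Proof.
move=> [k [m IE]] u0.
have u_gt0 : (0 < u)%N by rewrite lt0n; apply: contra u0 => /eqP h; apply/eqP/val_inj.
have up := Fp_ltn u.
have valN : ((- u)%R : nat) = (p - u)%N.
  by rewrite /= [X in (_ %% X)%N]Fp_cast // [X in (X - _)%N]Fp_cast // modn_small // ltn_subrL u_gt0 prime_gt0.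
rewrite valN.
have := Fp_fourier_progression pr zetap unit_root_neq1 (k%:~R) m u0.
rewrite /Fp_exp norm_1B_unit_root ?prime_gt0 //; last exact: ltnW.
have -> : [set x | [exists i : 'I_m, x == k%:~R + i%:R]] = I.
  rewrite IE; apply/setP => x; rewrite !inE; apply: eq_existsb => i.
  by rewrite intrD.
have /complex_realP[A AE] : `|Fp_fourier zeta I u| \is Num.real by apply: normr_real.
have A0 : 0 <= A by rewrite -ler0c -AE.
rewrite AE -rmorphM -[2 : R[i]](rmorph_nat (real_complex R)) !lecR.
rewrite mulrCA -[X in _ <= X]mulr1 ler_pM2l ?ltr0n // => As.
have pR : 0 < p%:R :> R by rewrite ltr0n prime_gt0.
have key v : (0 < v)%N -> 2 / 3 * (v%:R / p%:R) <= sin (PI * ((u : nat)%:R / p%:R))%R ->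
    A <= 3 / 2 * p%:R * v%:R^-1.
  move=> v0 hs; have vR : 0 < v%:R :> R by rewrite ltr0n.
  have : A * (2 / 3 * (v%:R / p%:R)) <= 1 by apply: le_trans As; apply: ler_wpM2l.
  have -> : A * (2 / 3 * (v%:R / p%:R)) = A / (3 / 2 * p%:R * v%:R^-1).
    by field; rewrite !lt0r_neq0.
  by rewrite ler_pdivrMr ?mul1r //; do 3?[apply: mulr_gt0]; rewrite ?invr_gt0 ?ltr0n ?(prime_gt0 pr).
have c0 : 0 <= 3 / 2 * p%:R :> R by rewrite !mulr_ge0 ?invr_ge0 ?ler0n.
have [|h|h] := @sin_ge u; first by rewrite u_gt0.
  apply: le_trans (key _ u_gt0 h) _; apply: ler_wpM2l => //.
  by rewrite lerDl invr_ge0 ler0n.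
apply: le_trans (key _ _ h) _; first by rewrite subn_gt0.
by apply: ler_wpM2l => //; rewrite lerDr invr_ge0 ler0n.
Qed.

(** The map [u -> -u] identifies the two reciprocal sums, each at most [1 + ln p <= 3 ln p]; hence
    [9 = 3/2 * 2 * 3]. *)
Lemma Fp_fourier_l1_interval (I : {set 'F_p}) : is_interval I ->
  Fp_fourier_l1 zeta I <= (9 * p%:R * ln p%:R)%:C.
Proof.
move=> Iint.
apply: le_trans (ler_sum _ (fun u => Fp_fourier_interval_bound Iint)) _.
rewrite -rmorph_sum lecR -mulr_sumr big_split /=.
have -> : \sum_(u : 'F_p | u != 0) ((- u)%R : nat)%:R^-1 =
    \sum_(u : 'F_p | u != 0) (u : nat)%:R^-1 :> R.
  by rewrite [RHS](reindex_inj oppr_inj); apply: eq_bigl => u; rewrite oppr_eq0.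
(* ['F_p] is an ordinal type on [(Zp_trunc (pdiv p)).+2 = p] elements; dropping 0 leaves [p - 1]
   terms. *)
have -> : \sum_(u : 'F_p | u != 0) (u : nat)%:R^-1 =
    \sum_(i < (Zp_trunc (pdiv p)).+1) (i.+1)%:R^-1 :> R.
  rewrite big_mkcond big_ord_recl /= add0r; apply: eq_bigr => i _.
  by rewrite /bump add1n.
have hh := harmonic_le (Zp_trunc (pdiv p)).
have lp : ln ((Zp_trunc (pdiv p)).+1)%:R <= ln p%:R :> R.
  apply/RleP; left; apply: ln_increasing; apply/RltP; first by rewrite ltr0n.
  by rewrite ltr_nat -[X in (_ < X)%N](Fp_cast pr).
have hl := ln_ge_half (prime_gt1 pr).
set h := \sum_(i < _) _ in hh *.
have : h <= 3 * ln p%:R.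
  apply: le_trans hh _.
  rewrite (_ : 3 * ln p%:R = ln p%:R *+ 2 + ln p%:R); last by rewrite -mulr_natl; ring.
  apply: lerD => //; rewrite -[_ *+ 2]mulr_natl.
  by rewrite -[X in X <= _](@divff R 2%:R) ?pnatr_eq0 // ler_pM2l ?ltr0n.
move=> h3.
rewrite (_ : 3 / 2 * _ * (h + h) = 3 * p%:R * h); last by field.
rewrite (_ : 9 * _ * _ = 3 * p%:R * (3 * ln p%:R)); last by ring.
by apply: ler_wpM2l => //; rewrite mulr_ge0 ?ler0n.
Qed.

End Interval.

(** * The discrepancy of inversion *)

Lemma lambda_map_inj (p : nat) (a : 'F_p) : a != 0 -> injective (@lambda_map (pdiv p) a).
Proof.
move=> a0 x y; rewrite /lambda_map.
have nz (z : 'F_p) : z != 0 -> a / z != 0 by move=> z0; rewrite mulf_neq0 ?invr_eq0.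
case: eqVneq => [-> | x0]; case: eqVneq => [-> // | y0] h.
- by have := nz _ y0; rewrite -h eqxx.
- by have := nz _ x0; rewrite h eqxx.
exact/invr_inj/(mulfI a0).
Qed.

(** The constant is [324 = 4 * 9 * 9]: the factor 4 of [twisted_sum_bound] and one 9 for each
    interval. The two factors [p] cancel the [p^2] of the completion. *)
Lemma discr_lambda_map (p : nat) (a : 'F_p) (I J : {set 'F_p}) :
  prime p -> a != 0 -> is_interval I -> is_interval J ->
  Rle (@discr (pdiv p) J (@lambda_map (pdiv p) a @: I))
    (Rmult (Rmult (INR 324) (sqrt (INR p))) (pow (ln (INR p)) 2)).
Proof.
move=> pr a0 Iint Jint; set zeta := unit_root p.
have zetap : zeta ^+ p = 1 by apply/unit_root_exp/prime_gt0.
have zeta1 : zeta != 1 := unit_root_neq1 pr.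
have linj := lambda_map_inj a0.
have pR : 0 < (p%:R : R) by rewrite ltr0n prime_gt0.
have r2 : (Num.sqrt (p%:R : R))%:C ^+ 2 = p%:R :> R[i].
  by rewrite -rmorphXn /= sqr_sqrtr ?ltW // rmorph_nat.
have r0 : 0 <= (Num.sqrt (p%:R : R))%:C by rewrite ler0c sqrtr_ge0.
have := discrepancy_completion pr zetap zeta1 I J linj
  (twisted_sum_bound pr zetap zeta1 a0 r0 r2).
rewrite /discr (_ : _ @: I :&: J = lambda_map a @: [set x in I | lambda_map a x \in J]); last first.
  apply/setP => y; rewrite inE; apply/andP/imsetP => [[/imsetP[x xI ->] h]|[x]].
    by exists x; rewrite // inE xI.
  by rewrite inE => /andP[xI xJ] ->; rewrite imset_f.
rewrite !card_imset // RabsE RminusE RdivE RmultE !INRE RsqrtE RpowE !RmultE.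
move=> hC; apply/RleP; rewrite -lecR -norm_real_complex.
have pdR : (pdiv p)%:R = p%:R :> R by rewrite pdiv_id.
rewrite pdR rmorphB fmorph_div rmorphM !rmorph_nat /= -natrM.
apply: le_trans hC _.
have pC : 0 < (p%:R : R[i]) ^+ 2 by rewrite exprn_gt0 // ltr0n prime_gt0.
rewrite ler_pdivrMr //.
have A0 K : 0 <= Fp_fourier_l1 zeta K by apply: sumr_ge0.
have hI := Fp_fourier_l1_interval pr Iint; have hJ := Fp_fourier_l1_interval pr Jint.
apply: le_trans (_ : 4 * (Num.sqrt (p%:R : R))%:C * (9 * p%:R * ln p%:R)%:C * (9 * p%:R * ln p%:R)%:C <= _).
  by apply: ler_pM => //; rewrite ?mulr_ge0 ?ler0n //; apply: ler_wpM2l; rewrite ?mulr_ge0 ?ler0n.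
rewrite -[4](rmorph_nat (real_complex R)) -(rmorph_nat (real_complex R) p) -rmorphXn -!rmorphM lecR.
by rewrite le_eqVlt; apply/orP; left; apply/eqP; rewrite /=; ring.
Qed.

(** [0 <= B] accounts for the initial value [R0] of the iterated maximum. *)
Lemma big_Rmax_le (T : finType) (A : pred T) (f : T -> R) (B : R) :
  Rle 0 B -> (forall x, A x -> Rle (f x) B) -> Rle (\big[Rmax/R0]_(x | A x) f x) B.
Proof.
move=> B0 fB; elim/big_ind: _ => // x y hx hy; exact: Rmax_lub.
Qed.

Theorem mainTheorem7 :
  exists C : R, forall (p : nat) (a : 'Z_p),
    prime p -> a \is a GRing.unit ->
    Rle (Dperm (lambda_map a)) (Rmult (Rmult C (sqrt (INR p))) (pow (ln (INR p)) 2)).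
Proof.
exists (INR 324) => p a pr.
set B := Rmult (Rmult _ _) _.
(* The field structure lives on ['F_p], that is ['Z_(pdiv p)]. Abstracting the modulus, with [B]
   kept fixed, lets [pdiv p = p] be rewritten despite the dependent types. *)
pose bounded n := forall a' : 'Z_n, a' \is a GRing.unit -> Rle (Dperm (lambda_map a')) B.
suff : bounded (pdiv p) by rewrite (pdiv_id pr); apply.
move=> a' ua; have B0 : Rle 0 B.
  apply/RleP; rewrite /B !RmultE RpowE; apply: mulr_ge0; last exact: sqr_ge0.
  by apply: mulr_ge0; [rewrite INRE ler0n | apply/RleP/sqrt_pos].
have intP (K : {set 'F_p}) : is_intervalb K -> is_interval K.
  by rewrite /is_intervalb; case: excluded_middle_informative.
apply: big_Rmax_le => // I /intP Iint; apply: big_Rmax_le => // J /intP Jint.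
by apply: discr_lambda_map => //; rewrite -unitfE.
Qed.
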